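(* For every integer $n \geq 1$, \[ \langle \mathrm{Frob}(R_n^{(0,3)};u,v,w), s_{(1^n)}\rangle = s_{(n-1)}(u,v,w)+s_{(n-2,1,1)}(u,v,w) = \binom{n+1}{2}_{u,v,w} + uvw\binom{n-1}{2}_{u,v,w}. \]
   Context: Let $\mathbb{Q}[\boldsymbol{\theta}_n,\boldsymbol{\xi}_n,\boldsymbol{\rho}_n]$ be the $\mathbb{Q}$-algebra generated by $3n$ variables $\theta_1,\dots,\theta_n,\xi_1,\dots,\xi_n,\rho_1,\dots,\rho_n$ which pairwise anticommute (so each variable squares to $0$); i.e. the exterior algebra on these $3n$ generators. The symmetric group $\mathfrak{S}_n$ acts diagonally by $\sigma(\theta_i)=\theta_{\sigma(i)}$, $\sigma(\xi_i)=\xi_{\sigma(i)}$, $\sigma(\rho_i)=\rho_{\sigma(i)}$. The triagonal fermionic coinvariant ring is $R_n^{(0,3)} := \mathbb{Q}[\boldsymbol{\theta}_n,\boldsymbol{\xi}_n,\boldsymbol{\rho}_n]/I$, where $I$ is the ideal generated by all $\mathfrak{S}_n$-invariant elements with zero constant term. It is trigraded: $(R_n^{(0,3)})_{a,b,c}$ is the image of the span of monomials with exactly $a$ variables from $\boldsymbol{\theta}_n$, $b$ from $\boldsymbol{\xi}_n$ and $c$ from $\boldsymbol{\rho}_n$; each component is an $\mathfrak{S}_n$-module. $\mathrm{Frob}(R_n^{(0,3)};u,v,w)=\sum_{a,b,c}F\,\mathrm{char}((R_n^{(0,3)})_{a,b,c})\,u^av^bw^c$, where $F$ is the Frobenius characteristic;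 thus $\langle \mathrm{Frob}(R_n^{(0,3)};u,v,w), s_{(1^n)}\rangle=\sum_{a,b,c} m_{a,b,c}u^av^bw^c$ with $m_{a,b,c}$ the multiplicity of the sign representation in $(R_n^{(0,3)})_{a,b,c}$. Here $s_\lambda(u,v,w)$ is the Schur polynomial in three variables (taken to be $0$ if $\lambda$ is not a partition), and $\binom{k}{2}_{u,v,w}:=s_{(k-2)}(u,v,w)$ (the complete homogeneous symmetric polynomial of degree $k-2$ in $u,v,w$, zero if $k<2$). *)

(* Defs.v *)
From HB Require Import structures.
From mathcomp Require Import all_boot all_order all_algebra all_fingroup.
From mathcomp Require Import mpoly.
Set Implicit Arguments.
Unset Strict Implicit.
Unset Printing Implicit Defensive.
Import GRing.Theory.
Local Open Scope ring_scope.

(* The exterior algebra Q[theta_n, xi_n, rho_n] on 3n generators.      *)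
(* A generator is a pair (k, i) : 'I_3 * 'I_n, with k = 0 for theta_i, *)
(* k = 1 for xi_i and k = 2 for rho_i.                                 *)
(* An element is a Q-linear combination of the basis monomials e_S,    *)
(* S a set of generators, where e_S is the product of the generators   *)
(* of S taken in increasing order of enum_rank.                        *)

Definition gen (n : nat) : finType := ('I_3 * 'I_n)%type.

Definition ext (n : nat) := {ffun {set gen n} -> rat}.

Section Exterior.
Variable n : nat.
Local Notation G := (gen n).
Local Notation A := (ext n).

Definition emon (S : {set G}) : A := [ffun T => (T == S)%:R].

Definition ext_zero : A := [ffun _ => 0].
Definition ext_one : A := emon set0.
Definition ext_add (x y : A) : A := [ffun S => x S + y S].
Definition ext_scale (c : rat) (x : A) : A := [ffun S => c * x S].
Definition ext_sum (s : seq A) : A := foldr ext_add ext_zero s.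

Definition ninv (S T : {set G}) : nat :=
  #|[set p : G * G | (p.1 \in S) && (p.2 \in T) &&
                     (enum_rank p.2 < enum_rank p.1)%N]|.

Definition mul_mon (S T : {set G}) : A :=
  if [disjoint S & T] then ext_scale ((-1) ^+ ninv S T) (emon (S :|: T))
  else ext_zero.

Definition ext_mul (x y : A) : A :=
  [ffun U => \sum_(S : {set G}) \sum_(T : {set G}) x S * y T * mul_mon S T U].

Definition gen_prod (s : seq G) : A :=
  foldr (fun g acc => ext_mul (emon [set g]) acc) ext_one s.

(* diagonal action of sigma in S_n: (k,i) |-> (k, sigma i), extended to *)
(* an algebra automorphism                                              *)
Definition act_gen (s : 'S_n) (g : G) : G := (g.1, s g.2).

Definition ext_act (s : 'S_n) (x : A) : A :=
  ext_sum [seq ext_scale (x Y) (gen_prod [seq act_gen s g | g <- enum Y])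
          | Y : {set G}].

Definition inv0 (f : A) : Prop :=
  (forall s : 'S_n, ext_act s f = f) /\ f set0 = 0.

Definition in_ideal (x : A) : Prop :=
  exists l : seq (A * A * A),
    (forall t, t \in l -> inv0 t.1.2) /\
    x = ext_sum [seq ext_mul (ext_mul t.1.1 t.1.2) t.2 | t <- l].

Definition ndeg (k : 'I_3) (S : {set G}) : nat := #|[set g in S | g.1 == k]|.

Definition trideg (a b c : nat) (S : {set G}) : bool :=
  [&& ndeg 0 S == a, ndeg 1 S == b & ndeg 2 S == c].

Definition in_tri (a b c : nat) (x : A) : Prop :=
  forall S, ~~ trideg a b c S -> x S = 0.

Definition dimP (P : A -> Prop) (d : nat) : Prop :=
  exists X : 'I_d -> A,
    (forall i, P (X i)) /\
    (forall c : 'I_d -> rat,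
        ext_sum [seq ext_scale (c i) (X i) | i : 'I_d] = ext_zero ->
        forall i, c i = 0) /\
    (forall x, P x -> exists c : 'I_d -> rat,
        x = ext_sum [seq ext_scale (c i) (X i) | i : 'I_d]).

(* R_{a,b,c} = image of the trigrade-(a,b,c) span in the quotient by I,  *)
(* i.e. Vabc / (Vabc n I).  Its sign-isotypic part is                   *)
(*   {x + I : x in Vabc, sigma.x - sgn(sigma) x in I for all sigma}     *)
(* so its dimension is dim(signpre) - dim(ideal_tri).                   *)
Definition signpre (a b c : nat) (x : A) : Prop :=
  in_tri a b c x /\
  forall s : 'S_n,
    in_ideal (ext_add (ext_act s x) (ext_scale (- (-1) ^+ odd_perm s) x)).

Definition ideal_tri (a b c : nat) (x : A) : Prop :=
  in_tri a b c x /\ in_ideal x.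

Definition sign_mult (a b c m : nat) : Prop :=
  exists dU dW, dimP (signpre a b c) dU /\ dimP (ideal_tri a b c) dW /\
                m = (dU - dW)%N.

End Exterior.

(* Symmetric polynomials in the three variables u = 'X_0, v = 'X_1,   *)
(* w = 'X_2.                                                           *)

Definition poly3 := {mpoly rat[3]}.

Definition hcomp (k : nat) : poly3 :=
  \sum_(m : 'X_{1..3 < k.+1} | mdeg m == k) 'X_[(m : 'X_{1..3})].

Definition hcompZ (k : int) : poly3 :=
  match k with Posz k' => hcomp k' | Negz _ => 0 end.

Definition is_partition (la : seq int) : bool :=
  sorted (fun x y : int => (y <= x)%R) la && all (fun x : int => (0 <= x)%R) la.

(* Schur polynomial s_la(u,v,w), via the Jacobi-Trudi formula; *)
(* 0 if la is not a partition                                   *)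
Definition schur3 (la : seq int) : poly3 :=
  if is_partition la then
    \det (\matrix_(i < size la, j < size la)
            hcompZ (nth 0 la i - i%:Z + j%:Z))
  else 0.

Definition qbinom2 (k : nat) : poly3 :=
  if (2 <= k)%N then schur3 [:: (k - 2)%:Z] else 0.

Definition mono3 (a b c : nat) : poly3 :=
  'X_(0 : 'I_3) ^+ a * 'X_(1 : 'I_3) ^+ b * 'X_(2 : 'I_3) ^+ c.

(* Main.v *)
From HB Require Import structures.
From mathcomp Require Import all_boot all_order all_algebra all_fingroup.
From mathcomp Require Import mpoly zify ring lra.
From Stdlib Require Import Classical.
Require Import Defs.
Set Implicit Arguments.
Unset Strict Implicit.
Unset Printing Implicit Defensive.
Import Order.TTheory GRing.Theory Num.Theory.
Local Open Scope ring_scope.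

(* A sign-isotypic class survives in the quotient iff some linear functional  *)
(* phi, alternating under S_n and zero on the ideal, detects it.  Such a phi  *)
(* is an alternating function F of words in the generators that vanishes on   *)
(* products with power sums.  Record a word by the letter (product of some of *)
(* theta, xi, rho) sitting at each site: permuting sites permutes letters up  *)
(* to a sign, and a power sum acts as a derivation on lists of letters.       *)
(* Writing 1 for the empty site, x, y, z for the single variables, a, b, c    *)
(* for the two-variable sites and t for the full one, the derivations kill    *)
(* every configuration with more than n variables (the key identity is        *)
(* [n F(1 t f) = 0] for f a monomial in x, y, z), and with n variables they   *)
(* give [n C = c (A + B + C)] and its rotations for the three configurations  *)
(* A, B, C with one empty and one double site.  With n - 1 variables only     *)
(* 1 f survives.  Conversely, determinants with a row of ones provide a       *)
(* nonzero functional in degree n - 1, and a weighted sum of such             *)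
(* determinants does in degree n when a, b, c > 0.  So each tridegree has     *)
(* multiplicity 0 or 1, and [h_(n-1) + uvw h_(n-3)] is their generating       *)
(* polynomial.                                                                *)

(** * The exterior algebra and alternating functions of words *)

(** Let N be the number of sites ([n.+1] in most sections). The multiplicity in a tridegree counts
    the independent sign-equivariant functionals on it that kill the ideal: in characteristic zero a
    functional killing the ideal can be antisymmetrised, so a sign class outside the ideal is
    detected by one ([phiF_good]). Read on words, such functionals are [good] functions.

    Upper bound. Up to sign a good function depends only on the letters standing on the sites.
    Letters with an even number of variables anticommute ([Fw_swap]), so in a nonzero value the
    empty letter and each two-variable letter occur at most once. Vanishing on multiples of power
    sums says that certain derivations on lists of letters are zero ([Dw0]). Well-chosen derivations
    remove the full letter ([empty_full], [full_empty]) and all but one two-variable letter, leaving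
    the shapes of [Fw_form]. In degree N - 1 one value remains. In degree N, [pair_rel] is a linear
    system whose solutions (A, B, C) are proportional to (a, b, c), and it forces 0 when one of a,
    b, c is 0 ([pairs_vanish]). [good_vanish] collects this.

    Lower bound. [Flow] is a determinant with a row of ones and one row per variable; [Ftop] sums
    such determinants over pairs of variables on a common site. Both kill the ideal ([liftF_ideal]):
    a short cofactor misses two sites, whose transposition fixes the invariant but reverses the
    sign, and a long cofactor sees only the linear part of the invariant.

    [sign_mult0] and [sign_mult1] turn these bounds into multiplicities. [mult_sum] sums them to
    h_(N-1) + uvw h_(N-3), and [schur3_hook] identifies the second term by Jacobi-Trudi. *)

Definition extA (n : nat) : vectType rat := {ffun {set gen n} -> rat^o}.

Section Exterior.
Variable n : nat.
Local Notation G := (gen n).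
Local Notation A := (extA n).
Implicit Types (S T U : {set G}) (x y z : A) (w u v : seq G).

Lemma ext_addE x y : ext_add x y = x + y :> A.
Proof. by apply/ffunP=> S; rewrite !ffunE. Qed.

Lemma ext_zeroE : ext_zero n = 0 :> A.
Proof. by apply/ffunP=> S; rewrite !ffunE. Qed.

Lemma ext_scaleE c x : ext_scale c x = c *: x :> A.
Proof. by apply/ffunP=> S; rewrite !ffunE. Qed.

Lemma ext_sumE (I : Type) (s : seq I) (f : I -> A) :
  ext_sum [seq f i | i <- s] = \sum_(i <- s) f i :> A.
Proof.
elim: s => [|i s IH] /=; first by rewrite big_nil ext_zeroE.
by rewrite big_cons -IH ext_addE.
Qed.

Definition emonA S : A := emon S.

Lemma emonE S T : emonA S T = (T == S)%:R.
Proof. by rewrite ffunE. Qed.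

Lemma ext_decomp x : x = \sum_S x S *: emonA S.
Proof.
apply/ffunP=> T; rewrite sum_ffunE (bigD1 T) //= big1 ?addr0.
  by rewrite ffunE emonE eqxx /GRing.scale /= mulr1.
by move=> S ne; rewrite ffunE emonE eq_sym (negPf ne) /GRing.scale /= mulr0.
Qed.

Definition mulA x y : A := ext_mul x y.

Definition mcoef S T : rat := if [disjoint S & T] then (-1) ^+ ninv S T else 0.

Lemma mul_monE S T : mul_mon S T = mcoef S T *: emonA (S :|: T) :> A.
Proof.
rewrite /mul_mon /mcoef; case: ifP => _; first by rewrite ext_scaleE.
by rewrite ext_zeroE scale0r.
Qed.

Lemma mulAE x y :
  mulA x y = \sum_S \sum_T (x S * y T * mcoef S T) *: emonA (S :|: T).
Proof.
apply/ffunP=> U; rewrite ffunE sum_ffunE; apply: eq_bigr => S _.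
rewrite sum_ffunE; apply: eq_bigr => T _.
by rewrite mul_monE !ffunE /GRing.scale /= !mulrA.
Qed.

Lemma mulA_linl y : linear (fun x => mulA x y).
Proof.
move=> c x x'; rewrite !mulAE scaler_sumr -big_split; apply: eq_bigr => S _.
rewrite scaler_sumr -big_split; apply: eq_bigr => T _ /=.
by rewrite scalerA -scalerDl !ffunE /GRing.scale /=; congr (_ *: _); ring.
Qed.

Lemma mulA_linr x : linear (mulA x).
Proof.
move=> c y y'; rewrite !mulAE scaler_sumr -big_split; apply: eq_bigr => S _.
rewrite scaler_sumr -big_split; apply: eq_bigr => T _ /=.
by rewrite scalerA -scalerDl !ffunE /GRing.scale /=; congr (_ *: _); ring.
Qed.

HB.instance Definition _ x := GRing.isLinear.Build rat A A _ (mulA x) (mulA_linr x).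
Definition mulAr y x := mulA x y.
HB.instance Definition _ y := GRing.isLinear.Build rat A A _ (mulAr y) (mulA_linl y).

Lemma mulA_suml (I : Type) (r : seq I) (P : pred I) (f : I -> A) y :
  mulA (\sum_(i <- r | P i) f i) y = \sum_(i <- r | P i) mulA (f i) y.
Proof. exact: (linear_sum (mulAr y)). Qed.

Lemma mulAZl c x y : mulA (c *: x) y = c *: mulA x y.
Proof. exact: (linearZ_LR (mulAr y)). Qed.

Lemma mul_emon S T : mulA (emonA S) (emonA T) = mcoef S T *: emonA (S :|: T).
Proof.
rewrite mulAE (bigD1 S) //= (bigD1 T) //= !emonE !eqxx !mul1r.
rewrite big1 ?addr0 => [|T' ne]; last first.
  by rewrite emonE (negPf ne) mulr0 mul0r scale0r.
rewrite big1 ?addr0 // => S' ne; apply: big1 => T' _.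
by rewrite emonE (negPf ne) !mul0r scale0r.
Qed.

Lemma ninvE S T :
  ninv S T = (\sum_(s in S) \sum_(t in T) (enum_rank t < enum_rank s))%N.
Proof.
rewrite /ninv -sum1_card pair_big_dep /= big_mkcond [RHS]big_mkcond.
apply: eq_bigr => -[s t] _ /=; rewrite inE /=.
by case: (s \in S); case: (t \in T) => //=; case: ifP.
Qed.

Lemma ninvUl S T U : [disjoint S & T] -> ninv (S :|: T) U = (ninv S U + ninv T U)%N.
Proof. by move=> dST; rewrite !ninvE -(bigU _ _ _ dST); apply: eq_bigl => s; rewrite !inE. Qed.

Lemma ninvUr S T U : [disjoint T & U] -> ninv S (T :|: U) = (ninv S T + ninv S U)%N.
Proof.
by move=> dTU; rewrite !ninvE -big_split; apply: eq_bigr => s _; rewrite -(bigU _ _ _ dTU);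
  apply: eq_bigl => t; rewrite !inE.
Qed.

Lemma disjointUl S T U :
  [disjoint S :|: T & U] = [disjoint S & U] && [disjoint T & U].
Proof. by rewrite -!setI_eq0 setIUl setU_eq0. Qed.

Lemma disjointUr S T U :
  [disjoint S & T :|: U] = [disjoint S & T] && [disjoint S & U].
Proof. by rewrite -!setI_eq0 setIUr setU_eq0. Qed.

(** Both sides count the inversions between each two of the three sets, and both vanish as soon as
    two of them meet. *)
Lemma mcoefA S T U :
  mcoef S T * mcoef (S :|: T) U = mcoef T U * mcoef S (T :|: U).
Proof.
rewrite /mcoef disjointUl disjointUr.
have [dST|_] := boolP [disjoint S & T]; have [dTU|_] := boolP [disjoint T & U];
  rewrite ?(mul0r, mulr0, andbF, andbT) //=.
case: ifP => _; rewrite ?mulr0 // ninvUl // ninvUr // !exprD.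
by rewrite [RHS]mulrC mulrA.
Qed.

Lemma mulA_assoc x y z : mulA (mulA x y) z = mulA x (mulA y z).
Proof.
have mon S T U : mulA (mulA (emonA S) (emonA T)) (emonA U) =
                 mulA (emonA S) (mulA (emonA T) (emonA U)).
  by rewrite !mul_emon mulAZl linearZ /= !mul_emon !scalerA mcoefA setUA.
rewrite (ext_decomp x) !mulA_suml; apply: eq_bigr => S _.
rewrite !mulAZl; congr (_ *: _).
rewrite (ext_decomp y) !mulA_suml !linear_sum mulA_suml; apply: eq_bigr => T _.
rewrite !mulAZl !linearZ /= mulAZl; congr (_ *: _).
rewrite (ext_decomp z) !linear_sum /=; apply: eq_bigr => U _.
by rewrite !linearZ /= mon.
Qed.

Definition gprod w : A := gen_prod w.

Lemma gprod_cons g w : gprod (g :: w) = mulA (emonA [set g]) (gprod w).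
Proof. by []. Qed.

Lemma mul1A x : mulA (emonA set0) x = x.
Proof.
rewrite {1}(ext_decomp x) linear_sum {2}(ext_decomp x); apply: eq_bigr => S _ /=.
rewrite linearZ /= mul_emon set0U /mcoef -setI_eq0 set0I eqxx.
by rewrite ninvE big_set0 expr0 scale1r.
Qed.

Lemma gprod_cat u v : gprod (u ++ v) = mulA (gprod u) (gprod v).
Proof.
elim: u => [|g u IH]; first by rewrite mul1A.
by rewrite cat_cons !gprod_cons IH mulA_assoc.
Qed.

Lemma gprod_swap g h w : gprod [:: g, h & w] = - gprod [:: h, g & w].
Proof.
rewrite !gprod_cons -!mulA_assoc !mul_emon !mulAZl setUC -scaleNr; congr (_ *: _).
rewrite /mcoef !disjoints1 !inE eq_sym; case: eqP => [->|/eqP ne] /=.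
  by rewrite oppr0.
rewrite !ninvE !big_set1.
have : (enum_rank g : nat) != enum_rank h.
  by apply: contraNneq ne => /ord_inj /enum_rank_inj ->.
by case: (ltngtP (enum_rank g)).
Qed.

End Exterior.

Section Alternating.
Variable n : nat.
Local Notation G := (gen n).
Local Notation A := (extA n).
Implicit Types (S T U : {set G}) (x y z : A) (w u v : seq G).

(** Functionals on the exterior algebra are handled as such functions of words; [gprod] is the
    universal one, by [liftF_gprod]. *)
Definition alternating (V : lmodType rat) (F : seq G -> V) :=
  forall l1 g h l2, F (l1 ++ [:: g, h & l2]) = - F (l1 ++ [:: h, g & l2]).

Lemma gprod_alt : alternating (@gprod n).
Proof. by move=> l1 g h l2; rewrite !gprod_cat gprod_swap linearN. Qed.

Section Words.
Variables (V : lmodType rat) (F : seq G -> V).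
Hypothesis altF : alternating F.

Lemma alt_move u v g w :
  F (u ++ v ++ g :: w) = (-1) ^+ size v *: F (u ++ g :: v ++ w).
Proof.
elim: v u => [|h v IH] u /=; first by rewrite expr0 scale1r.
by rewrite -cat_rcons IH cat_rcons altF exprS mulN1r scalerN scaleNr.
Qed.

Lemma alt_block u v1 v2 w :
  F (u ++ v1 ++ v2 ++ w) = (-1) ^+ (size v1 * size v2) *: F (u ++ v2 ++ v1 ++ w).
Proof.
elim: v2 u => [|g v2 IH] u /=; first by rewrite muln0 expr0 scale1r.
rewrite alt_move -cat_rcons IH scalerA -exprD cat_rcons.
by rewrite mulnS.
Qed.

Lemma alt_dup u v g w : F (u ++ g :: v ++ g :: w) = 0.
Proof.
have dup u' w' : F (u' ++ [:: g, g & w']) = 0.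
  have /eqP := altF u' g g w'; rewrite -subr_eq0 opprK -mulr2n -scaler_nat.
  by rewrite scaler_eq0 => /orP[/eqP //|/eqP].
by rewrite -cat_rcons alt_move cat_rcons dup scaler0.
Qed.

Lemma alt_nuniq w : ~~ uniq w -> F w = 0.
Proof.
move=> nu; suff [u [g [v [w' ->]]]] : exists u g v w', w = u ++ g :: v ++ g :: w'.
  exact: alt_dup.
elim: w nu => [|g w IH] //=; rewrite negb_and negbK => /orP[gw|/IH].
  by case/splitPr: gw => v w'; exists [::], g, v, w'.
by case=> u [h [v [w' ->]]]; exists (g :: u), h, v, w'.
Qed.

End Words.

Lemma alternating_prefix (V : lmodType rat) (F : seq G -> V) u :
  alternating F -> alternating (fun w => F (u ++ w)).
Proof. by move=> altF l1 g h l2; rewrite !catA altF. Qed.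

Lemma alternating_suffix (V : lmodType rat) (F : seq G -> V) u :
  alternating F -> alternating (fun w => F (w ++ u)).
Proof. by move=> altF l1 g h l2; rewrite -!catA altF. Qed.

(** The sign depends on the two words alone, so one [k] serves both [gprod] and an arbitrary
    function in [alternating_lift]. *)
Lemma alt_perm w w' : perm_eq w w' ->
  exists k, forall (V : lmodType rat) (F : seq G -> V),
    alternating F -> F w = (-1) ^+ k *: F w'.
Proof.
elim: w w' => [|g w IH] w' eqw.
  move: eqw; rewrite perm_sym => /perm_nilP ->.
  by exists 0%N => V F _; rewrite expr0 scale1r.
have gw' : g \in w' by rewrite -(perm_mem eqw) mem_head.
case/splitPr: gw' eqw => l1 l2.
rewrite perm_sym -cat1s perm_catCA perm_cons perm_sym.
move/IH => [k Hk]; exists (k + size l1)%N => V F altF.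
have := Hk V _ (alternating_prefix [:: g] altF) => /= ->.
by rewrite (alt_move altF [::]) scalerA exprD -mulrA -expr2 sqrr_sign mulr1.
Qed.

Lemma alt_perm0 (F : seq G -> rat^o) w w' :
  alternating F -> perm_eq w w' -> F w' = 0 -> F w = 0.
Proof. by move=> altF /alt_perm[k /(_ _ _ altF)->] ->; rewrite scaler0. Qed.

Lemma enum_pairwise (s : seq G) : uniq s ->
  pairwise (fun g h => index g s < index h s)%N s.
Proof.
case: s => [//|g s] us; apply/(pairwiseP g) => i j; rewrite !inE => li lj ij.
by rewrite !index_uniq.
Qed.

(** [enum S] lists the generators by increasing rank, so no inversion occurs and every sign is 1. *)
Lemma gprod_enum S : gprod (enum S) = emonA S.
Proof.
have: pairwise (fun x y : G => enum_rank x < enum_rank y)%N (enum S).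
  have := enum_pairwise (enum_uniq G); rewrite {3}enumT => /(pairwise_filter (mem S)).
  rewrite -[filter _ _]/(enum_mem _); apply: sub_pairwise => x y.
  rewrite /enum_rank !enum_rank_in.unlock !insubdK //.
    by rewrite unfold_in /= cardE index_mem mem_enum.
  by rewrite unfold_in /= cardE index_mem mem_enum.
rewrite -{3}(set_enum S); elim: (enum S) => [_|g w IH].
  by rewrite set_nil.
rewrite pairwise_cons => /andP[/allP gw /IH{}IH].
rewrite gprod_cons IH mul_emon set_cons /mcoef disjoints1 inE.
have -> : g \notin w by apply/negP => /gw; rewrite ltnn.
rewrite ninvE big_set1 big1 ?expr0 ?scale1r // => h; rewrite inE => /gw.
by case: ltngtP.
Qed.

(* An alternating function of words factors through the exterior algebra. *)
Lemma alternating_lift (V : lmodType rat) (F : seq G -> V) w :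
  alternating F -> \sum_S gprod w S *: F (enum S) = F w.
Proof.
move=> altF; have [uw|nuw] := boolP (uniq w); last first.
  rewrite (alt_nuniq altF) // big1 // => S _.
  by rewrite (alt_nuniq gprod_alt) // ffunE scale0r.
have pw : perm_eq w (enum [set x in w]).
  by apply: uniq_perm; rewrite ?enum_uniq // => g; rewrite mem_enum inE.
have [k Hk] := alt_perm pw; rewrite (Hk _ _ altF).
rewrite (bigD1 [set x in w]) //= big1 => [|S neS]; rewrite (Hk _ _ gprod_alt) gprod_enum.
  by rewrite addr0 ffunE emonE eqxx /GRing.scale /= mulr1.
by rewrite ffunE emonE (negPf neS) scaler0 scale0r.
Qed.

Definition liftF (V : lmodType rat) (F : seq G -> V) x := \sum_S x S *: F (enum S).

Lemma liftF_linear (V : lmodType rat) (F : seq G -> V) : linear (liftF F).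
Proof.
move=> c x y; rewrite /liftF scaler_sumr -big_split; apply: eq_bigr => S _.
by rewrite !ffunE /= scalerDl scalerA.
Qed.
HB.instance Definition _ (V : lmodType rat) (F : seq G -> V) :=
  GRing.isLinear.Build rat A V _ (liftF F) (liftF_linear F).

Lemma liftF_gprod (V : lmodType rat) (F : seq G -> V) w :
  alternating F -> liftF F (gprod w) = F w.
Proof. exact: alternating_lift. Qed.

Lemma gprod_decomp x : x = \sum_S x S *: gprod (enum S).
Proof. by rewrite {1}(ext_decomp x); apply: eq_bigr => S _; rewrite gprod_enum. Qed.

Definition actA (s : 'S_n) x : A := ext_act s x.

Lemma actAE s x : actA s x = liftF (fun w => gprod (map (act_gen s) w)) x.
Proof.
rewrite /actA /ext_act [LHS]ext_sumE big_enum; apply: eq_bigr => S _.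
by rewrite ext_scaleE.
Qed.

Lemma actA_linear s : linear (actA s).
Proof. by move=> c x y; rewrite !actAE linearP. Qed.
HB.instance Definition _ s := GRing.isLinear.Build rat A A _ (actA s) (actA_linear s).

Lemma alternating_map (V : lmodType rat) (F : seq G -> V) (f : G -> G) :
  alternating F -> alternating (fun w => F (map f w)).
Proof. by move=> altF l1 g h l2; rewrite !map_cat /= altF. Qed.

Lemma actA_gprod s w : actA s (gprod w) = gprod (map (act_gen s) w).
Proof. by rewrite actAE liftF_gprod //; exact: alternating_map gprod_alt. Qed.

Lemma actA_mul s x y : actA s (mulA x y) = mulA (actA s x) (actA s y).
Proof.
rewrite (gprod_decomp x) !(mulA_suml, linear_sum); apply: eq_bigr => S _ /=.
rewrite !(mulAZl, linearZ) /=; congr (_ *: _).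
rewrite (gprod_decomp y) !(linear_sum); apply: eq_bigr => T _ /=.
by rewrite !linearZ /= -gprod_cat !actA_gprod map_cat gprod_cat.
Qed.

Lemma act_genM (s t : 'S_n) g : act_gen t (act_gen s g) = act_gen (s * t)%g g.
Proof. by rewrite /act_gen /= permM. Qed.

Lemma actAM s t x : actA t (actA s x) = actA (s * t)%g x.
Proof.
rewrite (gprod_decomp x) !linear_sum; apply: eq_bigr => S _.
rewrite !linearZ /= !actA_gprod -map_comp; congr (_ *: gprod _).
by apply: eq_map => g; rewrite /= act_genM.
Qed.

(** The constant term is the lift of the alternating function that is 1 on the empty word and 0
    elsewhere. *)
Lemma gprod_set0 w : w != [::] -> gprod w set0 = 0.
Proof.
move=> nw; pose F w := ((w == [::])%:R : rat^o).
have altF : alternating F by case=> [|? ?] g h l2; rewrite /F /= oppr0.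
have E : \sum_S gprod w S *: F (enum S) = 0.
  by rewrite (alternating_lift w altF) /F (negPf nw).
rewrite -{}E (bigD1 set0) //= big1 => [|S nS]; rewrite /F.
  by rewrite enum_set0 eqxx addr0 /GRing.scale /= mulr1.
by rewrite -size_eq0 -cardE cards_eq0 (negPf nS) scaler0.
Qed.

(** * Power sums and the ideal of invariants *)

Definition site (i : 'I_n) (m : seq 'I_3) : seq G := [seq (k, i) | k <- m].

Definition psum (m : seq 'I_3) : A := \sum_i gprod (site i m).

Lemma psum_inv0 m : m != [::] -> inv0 (psum m).
Proof.
move=> nm; split=> [s|]; last first.
  rewrite sum_ffunE big1 // => i _; rewrite gprod_set0 //.
  by case: m nm.
rewrite -[ext_act s _]/(actA s _) linear_sum [RHS](reindex_inj (@perm_inj _ s)).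
apply: eq_bigr => i _ /=; rewrite actA_gprod; congr gprod.
by rewrite /site -map_comp.
Qed.

Lemma in_idealE x : in_ideal x <->
  exists l : seq (A * A * A), (forall t, t \in l -> inv0 t.1.2) /\
     x = \sum_(t <- l) mulA (mulA t.1.1 t.1.2) t.2.
Proof.
by split=> -[l [Hl ->]]; exists l; split=> //; rewrite [ext_sum _]ext_sumE.
Qed.

Lemma ideal0 : @in_ideal n (0 : A).
Proof. by apply/in_idealE; exists [::]; rewrite big_nil. Qed.

Lemma idealD x y : in_ideal x -> in_ideal y -> in_ideal (x + y).
Proof.
move=> /in_idealE[l [Hl ->]] /in_idealE[l' [Hl' ->]]; apply/in_idealE.
exists (l ++ l'); rewrite big_cat; split=> // t.
by rewrite mem_cat => /orP[/Hl|/Hl'].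
Qed.

Lemma ideal_scale c x : in_ideal x -> in_ideal (c *: x).
Proof.
move=> /in_idealE[l [Hl ->]]; apply/in_idealE.
exists [seq (c *: t.1.1, t.1.2, t.2) | t <- l]; split=> [t /mapP[t' /Hl ? ->] //|].
by rewrite scaler_sumr big_map; apply: eq_bigr => t _ /=; rewrite !mulAZl.
Qed.

Lemma ideal_inv f x : inv0 f -> in_ideal (mulA f x).
Proof.
move=> inv_f; apply/in_idealE; exists [:: (emonA set0, f, x)].
by split=> [t|]; rewrite ?inE ?big_seq1 /= ?mul1A // => /eqP->.
Qed.

End Alternating.

(** * Words given by one letter per site *)

(* The last condition says that the functional given by F kills every multiple *)
(* of the power sums [psum m].                                                 *)
Definition good (n : nat) (F : seq (gen n) -> rat) : Prop :=
  [/\ alternating (F : seq (gen n) -> rat^o),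
      forall (s : 'S_n) w, F (map (act_gen s) w) = (-1) ^+ s * F w &
      forall m w, m != [::] -> \sum_i F (site i m ++ w) = 0].

Section Letters.
Variable n : nat.
Local Notation N := n.+1.
Variable F : seq (gen N) -> rat.
Hypothesis goodF : good F.

Let altF : alternating (F : seq (gen N) -> rat^o). Proof. by case: goodF. Qed.

Notation letter := (seq 'I_3).
Implicit Types (m l : letter) (L P Q E : seq letter) (X Y : seq 'I_3).

Fixpoint word (o : nat) L : seq (gen N) :=
  if L is m :: L' then site (inord o) m ++ word o.+1 L' else [::].

(* Zero on lists of the wrong length, so that no size hypotheses are needed. *)
Definition Fw L : rat := if size L == N then F (word 0 L) else 0.

Lemma FwE L : size L = N -> Fw L = F (word 0 L).
Proof. by rewrite /Fw => ->; rewrite eqxx. Qed.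

Lemma word_cat o L L' : word o (L ++ L') = word o L ++ word (o + size L) L'.
Proof.
by elim: L o => [|m L IH] o /=; rewrite ?addn0 // IH catA addnS.
Qed.

Lemma size_site (i : 'I_N) m : size (site i m) = size m.
Proof. exact: size_map. Qed.

Lemma size_word o L : size (word o L) = size (flatten L).
Proof.
by elim: L o => [|m L IH] o //=; rewrite !size_cat IH size_site.
Qed.

Lemma act_site s (i : 'I_N) m : map (act_gen s) (site i m) = site (s i) m.
Proof. by rewrite /site -map_comp. Qed.

Lemma act_word_id (s : 'S_N) o L :
  (forall q, (o <= q < o + size L)%N -> s (inord q) = inord q) ->
  map (act_gen s) (word o L) = word o L.
Proof.
elim: L o => [|m L IH] o //= fix_s; rewrite map_cat act_site fix_s; last lia.
by rewrite IH // => q Hq; apply: fix_s; lia.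
Qed.

Lemma blockF u v1 v2 w :
  F (u ++ v1 ++ v2 ++ w) = (-1) ^+ (size v1 * size v2) * F (u ++ v2 ++ v1 ++ w).
Proof. exact: (alt_block altF). Qed.

(** The transposition of the two sites costs a sign, and exchanging the two blocks of variables
    costs the other. Hence single variables commute, while letters of even size anticommute. *)
Lemma Fw_swap L1 m m' L2 :
  Fw (L1 ++ [:: m, m' & L2]) =
  - (-1) ^+ (size m * size m') * Fw (L1 ++ [:: m', m & L2]).
Proof.
rewrite /Fw !size_cat /=; case: eqP => [sz|_]; last by rewrite mulr0.
rewrite !word_cat /= add0n; set p := size L1.
have lp : (p.+1 < N)%N by lia.
pose s := tperm (inord p : 'I_N) (inord p.+1).
have [_ act_F _] := goodF.
have /eqP := act_F s (word 0 L1 ++ site (inord p) m ++ site (inord p.+1) m' ++ word p.+2 L2).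
have ne : (inord p : 'I_N) != inord p.+1.
  by apply/eqP => /(congr1 val); rewrite /= !inordK; lia.
rewrite odd_tperm ne expr1 mulN1r -eqr_oppLR => /eqP <-.
have fix_s q : (q < N)%N -> q != p -> q != p.+1 -> s (inord q) = inord q.
  move=> lq qp qp1; rewrite tpermD //; apply/eqP => /(congr1 val);
  rewrite /= !inordK; lia.
rewrite !map_cat !act_site tpermL tpermR !act_word_id.
- by rewrite blockF !size_site mulNr.
- by move=> q; rewrite -/p => Hq; apply: fix_s; lia.
by move=> q; rewrite add0n -/p => Hq; apply: fix_s; lia.
Qed.

Lemma Fw_nuniq P m Q : ~~ uniq m -> Fw (P ++ m :: Q) = 0.
Proof.
move=> nu; rewrite /Fw; case: eqP => // _; apply: (alt_nuniq altF).
rewrite word_cat /= !cat_uniq.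
have -> : uniq (site (inord (0 + size P) : 'I_N) m) = uniq m.
  by apply: map_inj_uniq => a b [].
by rewrite (negPf nu) !andbF.
Qed.

Lemma Fw_rot P m m' Q :
  Fw (P ++ (m ++ m') :: Q) = (-1) ^+ (size m * size m') * Fw (P ++ (m' ++ m) :: Q).
Proof.
rewrite /Fw !size_cat /=; case: eqP => _; last by rewrite mulr0.
by rewrite !word_cat /= /site !map_cat -!catA blockF !size_map.
Qed.

Lemma Fw_perm_sign L L' : perm_eq L L' ->
  forall P, exists k : nat, Fw (P ++ L) = (-1) ^+ k * Fw (P ++ L').
Proof.
elim: L L' => [|m L IH] L' eqL P.
  by move: eqL; rewrite perm_sym => /perm_nilP ->; exists 0%N; rewrite mul1r.
have mL' : m \in L' by rewrite -(perm_mem eqL) mem_head.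
case/splitPr: mL' eqL => L1 L2.
rewrite perm_sym -cat1s perm_catCA perm_cons perm_sym => eqL.
have [k Hk] := IH _ eqL (rcons P m).
rewrite -!cat_rcons Hk cat_rcons {IH Hk eqL}.
suff [k' ->] : exists k' : nat, Fw (P ++ m :: L1 ++ L2) = (-1) ^+ k' * Fw (P ++ L1 ++ m :: L2).
  by exists (k + k')%N; rewrite exprD mulrA cat_rcons.
elim: L1 P => [|l L1 IH] P; first by exists 0%N; rewrite mul1r.
have [k' Hk'] := IH (rcons P l).
exists ((size m * size l).+1 + k')%N.
by rewrite /= Fw_swap -[P ++ [:: l, m & _]]cat_rcons Hk' cat_rcons exprD mulrA exprS mulN1r.
Qed.

Lemma Fw_perm0 L L' : perm_eq L L' -> Fw L' = 0 -> Fw L = 0.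
Proof. by move=> /Fw_perm_sign /(_ [::]) [k /= ->] ->; rewrite mulr0. Qed.

Lemma Fw_even_dup P m Q : ~~ odd (size m) -> Fw (P ++ [:: m, m & Q]) = 0.
Proof.
move=> ev; have := Fw_swap P m m Q.
rewrite -signr_odd oddM (negPf ev) /= expr0 mulN1r; lra.
Qed.

(** Multiplication by the power sum of [m] adds [m] to one letter at a time: a signed derivation,
    with [P] the letters already passed. *)
Fixpoint Dw m P L : rat :=
  if L is l :: L' then
    (-1) ^+ (size m * size (flatten P)) * Fw (P ++ (m ++ l) :: L') + Dw m (rcons P l) L'
  else 0.

Lemma DwE m P L : size (P ++ L) = N ->
  Dw m P L = \sum_(size P <= p < N) F (site (inord p) m ++ word 0 (P ++ L)).
Proof.
elim: L P => [|l L IH] P /= sz.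
  by rewrite cats0 in sz; rewrite sz big_geq.
rewrite big_ltn; last by rewrite -sz size_cat /=; lia.
rewrite IH ?cat_rcons // size_rcons; congr (_ + _).
rewrite /Fw ifT; last by rewrite -sz !size_cat.
have blk := blockF [::] (site (inord (size P)) m) (word 0 P).
rewrite !word_cat /= add0n blk size_site size_word.
by rewrite /site map_cat -!catA.
Qed.

(** For N letters this is the vanishing on multiples of [psum m]; for any other length each term is
    the default value 0. *)
Lemma Dw0 m L : m != [::] -> Dw m [::] L = 0.
Proof.
move=> nm; have [sz|sz] := eqVneq (size L) N.
  rewrite DwE // big_mkord; have [_ _ psF] := goodF.
  rewrite -[RHS](psF m (word 0 L)) //; apply: eq_bigr => i _; by rewrite inord_val.
have : size ([::] ++ L) != N by [].
elim: L [::] {sz} => [|l L IH] P //= sz.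
rewrite IH ?cat_rcons // /Fw ifF ?mulr0 ?addr0 //.
by apply/negbTE; move: sz; rewrite !size_cat.
Qed.

Lemma Dw_skip m P E L : all (fun l => ~~ uniq (m ++ l)) E ->
  Dw m P (E ++ L) = Dw m (P ++ E) L.
Proof.
elim: E P => [|l E IH] P /=; first by rewrite cats0.
by case/andP=> nu allE; rewrite Fw_nuniq // mulr0 add0r IH // cat_rcons.
Qed.

Definition singles X : seq letter := [seq [:: k] | k <- X].

Lemma Fw_move P X m Q :
  Fw (P ++ singles X ++ m :: Q) =
  (-1) ^+ ((size m).+1 * size X) * Fw (P ++ m :: singles X ++ Q).
Proof.
elim: X P => [|k X IH] P /=; first by rewrite muln0 mul1r.
rewrite -cat_rcons IH cat_rcons Fw_swap mul1n mulrA; congr (_ * _).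
by rewrite mulnS exprD mulrC exprS mulN1r.
Qed.

Lemma Fw_singles X Y : perm_eq X Y ->
  forall P, Fw (P ++ singles X) = Fw (P ++ singles Y).
Proof.
elim: X Y => [|k X IH] Y eqX P.
  by move: eqX; rewrite perm_sym => /perm_nilP ->.
have kY : k \in Y by rewrite -(perm_mem eqX) mem_head.
case/splitPr: kY eqX => Y1 Y2.
rewrite perm_sym -cat1s perm_catCA perm_cons perm_sym => eqX /=.
rewrite -cat_rcons (IH _ eqX) cat_rcons /singles !map_cat /= Fw_move.
by rewrite -signr_odd oddM /= mul1r.
Qed.

(** The sign of moving [m] past the singles [Y] cancels the sign of bringing the enlarged letter in
    front of them, so all terms share one sign. *)
Lemma Dw_singles_rec m P Y X :
  Dw m (P ++ singles Y) (singles X) =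
  (-1) ^+ (size m * size (flatten P)) *
    \sum_(k <- X) Fw (P ++ (m ++ [:: k]) :: singles (rem k (Y ++ X))).
Proof.
elim: X Y => [|k X IH] Y; first by rewrite big_nil mulr0.
rewrite big_cons mulrDr /=.
have -> : rcons (P ++ singles Y) [:: k] = P ++ singles (rcons Y k).
  by rewrite /singles map_rcons rcons_cat.
rewrite IH cat_rcons; congr (_ + _).
rewrite -catA Fw_move mulrA flatten_cat size_cat.
have -> : size (flatten (singles Y)) = size Y.
  by elim: Y {IH} => //= ? ? ->.
rewrite size_cat addn1 mulnDr; congr (_ * _).
  rewrite -exprD -signr_odd -[RHS]signr_odd !(oddD, oddM) /=.
  by case: (odd (size m)); case: (odd (size Y)); case: (odd (size (flatten P))).
have := @Fw_singles (Y ++ X) (rem k (Y ++ k :: X)) _ (rcons P (m ++ [:: k])).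
rewrite !cat_rcons /singles map_cat; apply.
rewrite -(perm_cons k) (perm_trans _ (perm_to_rem _)) //.
  by rewrite -cat1s perm_catCA.
by rewrite mem_cat mem_head orbT.
Qed.

Lemma sum_count (f : 'I_3 -> rat) X :
  \sum_(k <- X) f k = \sum_k (count_mem k X)%:R * f k.
Proof.
elim: X => [|k X IH]; first by rewrite big_nil big1 // => k _; rewrite mul0r.
rewrite big_cons IH [RHS](eq_bigr (fun i => (k == i)%:R * f i + (count_mem i X)%:R * f i)).
  rewrite big_split /=; congr (_ + _).
  rewrite (bigD1 k) //= eqxx mul1r big1 ?addr0 // => i.
  by rewrite eq_sym => /negPf ->; rewrite mul0r.
by move=> i _ /=; rewrite natrD mulrDl.
Qed.

Lemma Dw_singles m P X :
  Dw m P (singles X) =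
  (-1) ^+ (size m * size (flatten P)) *
    \sum_(k : 'I_3) (count_mem k X)%:R * Fw (P ++ (m ++ [:: k]) :: singles (rem k X)).
Proof.
rewrite -[P in LHS]cats0 (Dw_singles_rec m P [::]) /=; congr (_ * _).
exact: sum_count.
Qed.

Section Triple.
Variables k1 k2 k3 : 'I_3.
Hypothesis uniqk : uniq [:: k1; k2; k3].

Definition xyz i j k : seq 'I_3 := nseq i k1 ++ nseq j k2 ++ nseq k k3.
Definition Gw E i j k : rat := Fw (E ++ singles (xyz i j k)).

Let ne12 : k1 != k2. Proof. by move: uniqk; rewrite /= !inE; case: eqP. Qed.
Let ne13 : k1 != k3.
Proof. by move: uniqk; rewrite /= !inE negb_or; case: (k1 == k3); rewrite ?andbF. Qed.
Let ne23 : k2 != k3.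
Proof. by move: uniqk; rewrite /= !inE; case: (k2 == k3); rewrite ?andbF. Qed.

Lemma sum_triple (f : 'I_3 -> rat) : \sum_k f k = f k1 + f k2 + f k3.
Proof.
have pk : perm_eq (index_enum 'I_3) [:: k1; k2; k3].
  have [] := @uniq_min_size _ [:: k1; k2; k3] (index_enum 'I_3) uniqk.
  - by move=> k _; rewrite mem_index_enum.
  - by rewrite /index_enum -enumT size_enum_ord.
  by move=> _ eqk; rewrite perm_sym; apply: uniq_perm => //; exact: index_enum_uniq.
by rewrite (perm_big _ pk) /= !big_cons big_nil addr0 addrA.
Qed.

Lemma perm_rem_nseq (k : 'I_3) i Y Y' :
  perm_eq Y (nseq i.+1 k ++ Y') -> perm_eq (rem k Y) (nseq i k ++ Y').
Proof.
move=> eqY; rewrite -(perm_cons k); apply: (perm_trans _ eqY).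
by rewrite perm_sym perm_to_rem // (perm_mem eqY) mem_head.
Qed.

(** An exponent 0 makes its predecessor a default, but the coefficient 0 then removes the term. *)
Lemma Dw_xyz m P i j k :
  Dw m P (singles (xyz i j k)) =
  (-1) ^+ (size m * size (flatten P)) *
  (i%:R * Gw (P ++ [:: m ++ [:: k1]]) i.-1 j k +
   j%:R * Gw (P ++ [:: m ++ [:: k2]]) i j.-1 k +
   k%:R * Gw (P ++ [:: m ++ [:: k3]]) i j k.-1).
Proof.
rewrite Dw_singles sum_triple; congr (_ * _).
have cnt (l : 'I_3) : count_mem l (xyz i j k) = (i * (k1 == l) + (j * (k2 == l) + k * (k3 == l)))%N.
  by rewrite !count_cat !count_nseq /= ![(_ * nat_of_bool _)%N]mulnC.
rewrite !cnt !eqxx (negPf ne12) (negPf ne13) (negPf ne23) ![_ == k1]eq_sym ![k3 == k2]eq_sym.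
rewrite (negPf ne12) (negPf ne13) (negPf ne23) !muln0 !muln1 !add0n !addn0.
have aux p Y Y' l : perm_eq Y Y' ->
    p%:R * Fw (P ++ l :: singles Y) = p%:R * Fw (P ++ l :: singles Y').
  by move=> eqY; rewrite -!(cat_rcons l) (Fw_singles eqY).
rewrite /Gw -!catA /=; congr (_ + _ + _).
- case: i {cnt} => [|i]; first by rewrite !mul0r.
  by apply: aux; apply: perm_rem_nseq.
- case: j {cnt} => [|j]; first by rewrite !mul0r.
  apply: aux; rewrite perm_sym perm_catCA perm_sym; apply: perm_rem_nseq.
  by rewrite perm_catCA.
case: k {cnt} => [|k]; first by rewrite !mul0r.
apply: aux; rewrite perm_sym /xyz catA perm_catC perm_sym; apply: perm_rem_nseq.
by rewrite catA perm_catC.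
Qed.

End Triple.

End Letters.

(** * Vanishing in degree greater than n *)

Lemma perm_front (T : eqType) (s1 s2 s3 : seq T) :
  perm_eq (s1 ++ s2 ++ s3) (s2 ++ s1 ++ s3).
Proof. by rewrite perm_catCA. Qed.

Section Vanishing.
Variable n : nat.
Local Notation N := n.+1.
Variable F : seq (gen N) -> rat.
Hypothesis goodF : good F.
Notation letter := (seq 'I_3).
Local Notation Fw := (Fw F).

Lemma Gw_rot k1 k2 k3 E i j k : Gw F k2 k3 k1 E j k i = Gw F k1 k2 k3 E i j k.
Proof. by apply: Fw_singles => //; rewrite /xyz catA perm_catC. Qed.

Lemma big_nuniq (m l : letter) : (3 < size m + size l)%N -> ~~ uniq (m ++ l).
Proof.
move=> sz; apply/negP => /card_uniqP Hc.
have := max_card (mem (m ++ l)); rewrite Hc size_cat card_ord => le3.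
by move: (leq_trans sz le3).
Qed.

(* Notation for letters: [::] is the empty site, a, b, c the two-variable     *)
(* sites and t the full one; Gw E i j k is the value on the sites E followed  *)
(* by i, j, k sites carrying the single variables k1, k2, k3.                 *)
Section Triple.
Variables k1 k2 k3 : 'I_3.
Hypothesis uniqk : uniq [:: k1; k2; k3].
Local Notation G := (Gw F k1 k2 k3).
Local Notation a := [:: k2; k3].
Local Notation b := [:: k3; k1].
Local Notation c := [:: k1; k2].
Local Notation t := [:: k1; k2; k3].
Local Notation big := (all (fun l : letter => (1 < size l)%N)).

Lemma uniqk_rot : uniq [:: k2; k3; k1].
Proof. by have := uniqk; rewrite -(rot_uniq 1). Qed.

(** Replace [t] by the empty letter and let [t] act: no other letter can absorb three more
    variables. *)
Lemma full_no_empty L : [::] \notin L -> Fw (t :: L) = 0.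
Proof.
move=> nL; have := Dw0 goodF (m := t) ([::] :: L) isT.
rewrite /= muln0 expr0 mul1r -[L in Dw _ _ _ L]cats0 (Dw_skip goodF) /= ?addr0 //.
apply/allP=> l lL; apply: (@big_nuniq t l); rewrite /= !ltnS lt0n size_eq0.
by apply: contraNneq nL => <-.
Qed.

Lemma big_skip m E : (1 < size m)%N -> big E -> all (fun l => ~~ uniq (m ++ l)) E.
Proof.
move=> sm /allP bE; apply/allP=> l /bE sl; apply: big_nuniq; exact: (leq_add sm sl).
Qed.

Lemma G_nuniq E m i j k : ~~ uniq m -> G (E ++ [:: m]) i j k = 0.
Proof. by move=> nu; rewrite /Gw -catA /= (Fw_nuniq goodF). Qed.

Lemma nuniq_c1 : ~~ uniq (c ++ [:: k1]).
Proof. by rewrite /= !inE eqxx orbT. Qed.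
Lemma nuniq_c2 : ~~ uniq (c ++ [:: k2]).
Proof. by rewrite /= !inE eqxx andbF. Qed.

(** Replace [t] by the single [k3] and let [c] act. On the empty letter it creates a second [c],
    which gives 0; elsewhere variables repeat, except on the k + 1 singles [k3], which become
    [t]. *)
Lemma full_empty_c E i j k : big E -> G ([:: [::]; c] ++ E ++ [:: t]) i j k = 0.
Proof.
move=> bE; have := Dw0 goodF (m := c) ([:: [::], c & E ++ singles (xyz k1 k2 k3 i j k.+1)]) isT.
rewrite /= (Fw_even_dup goodF [::]) // mulr0 add0r (Fw_nuniq goodF [:: [::]]); last first.
  by rewrite /= !inE eqxx orbT.
rewrite mulr0 add0r (Dw_skip goodF) ?big_skip // (Dw_xyz goodF) //.
rewrite (G_nuniq _ _ _ _ nuniq_c1) (G_nuniq _ _ _ _ nuniq_c2).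
rewrite !mulr0 !add0r -signr_odd oddM /= expr0 mul1r.
by move/eqP; rewrite mulf_eq0 pnatr_eq0 /= => /eqP.
Qed.

(** Only the empty letter and the singles [k3] can absorb [c]. *)
Lemma c_to_full E i j k : big E ->
  G (c :: E) i j k + k%:R * G ([::] :: E ++ [:: t]) i j k.-1 = 0.
Proof.
move=> bE; have := Dw0 goodF (m := c) ([:: [::] & E ++ singles (xyz k1 k2 k3 i j k)]) isT.
rewrite /= muln0 expr0 mul1r (Dw_skip goodF) ?big_skip // (Dw_xyz goodF) //.
rewrite (G_nuniq _ _ _ _ nuniq_c1) (G_nuniq _ _ _ _ nuniq_c2).
rewrite !mulr0 !add0r -signr_odd oddM /= expr0 mul1r.
by [].
Qed.

End Triple.

Section Relations.
Variables k1 k2 k3 : 'I_3.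
Hypothesis uniqk : uniq [:: k1; k2; k3].
Local Notation G := (Gw F k1 k2 k3).
Local Notation a := [:: k2; k3].
Local Notation b := [:: k3; k1].
Local Notation c := [:: k1; k2].
Local Notation t := [:: k1; k2; k3].

Lemma Fw_t1 P Q : Fw (P ++ [:: k2; k3; k1] :: Q) = Fw (P ++ t :: Q).
Proof. by rewrite (Fw_rot goodF P [:: k2; k3] [:: k1]) /= sqrrN expr1n mul1r. Qed.

Lemma Fw_t2 P Q : Fw (P ++ [:: k3; k1; k2] :: Q) = Fw (P ++ t :: Q).
Proof. by rewrite (Fw_rot goodF P [:: k3] [:: k1; k2]) /= sqrrN expr1n mul1r. Qed.

Lemma Fw_13 P Q : Fw (P ++ [:: k1; k3] :: Q) = - Fw (P ++ b :: Q).
Proof. by rewrite (Fw_rot goodF P [:: k1] [:: k3]) /= mulN1r. Qed.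

Lemma a_to_full i j k : G [:: a] i j k + i%:R * G [:: [::]; t] i.-1 j k = 0.
Proof.
have := c_to_full (uniqk_rot uniqk) j k i (E := [::]) isT.
by rewrite !(Gw_rot k1 k2 k3) /= {2}/Gw /= (Fw_t1 [:: [::]]).
Qed.

Lemma b_to_full i j k : G [:: b] i j k + j%:R * G [:: [::]; t] i j.-1 k = 0.
Proof.
have := c_to_full (uniqk_rot (uniqk_rot uniqk)) k i j (E := [::]) isT.
by rewrite -!(Gw_rot k3 k1 k2) /= {2}/Gw /= (Fw_t2 [:: [::]]).
Qed.

(** Let [k1] act on the empty letter, [a] and singles; the minus signs come from moving the new
    single past [a] and from [[:: k1; k3]] being [b] reversed. *)
Lemma D1_empty_a i j k :
  - G [:: a] i.+1 j k + G [:: [::]; t] i j k +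
  j%:R * G [:: [::]; a; c] i j.-1 k - k%:R * G [:: [::]; a; b] i j k.-1 = 0.
Proof.
have := Dw0 goodF (m := [:: k1]) [:: [::], a & singles (xyz k1 k2 k3 i j k)] isT.
rewrite /= (Dw_xyz goodF) //= !mul1n !expr0 !mul1r.
rewrite (Fw_swap goodF [::]) /= mul1n sqrrN expr1n mulN1r.
rewrite (G_nuniq _ _ _ [:: [::]; a]) /= ?inE ?eqxx // mulr0 add0r.
have -> : G [:: [::]; a; [:: k1; k3]] i j k.-1 = - G [:: [::]; a; b] i j k.-1.
  exact: (Fw_13 [:: [::]; a]).
rewrite -[Fw [:: a, _ & _]]/(G [:: a] i.+1 j k).
rewrite -[Fw [:: [::], t & _]]/(G [:: [::]; t] i j k) mulrN; lra.
Qed.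

Lemma D1_empty_b i j k :
  - G [:: b] i.+1 j k + j%:R * G [:: [::]; b; c] i j.-1 k = 0.
Proof.
have := Dw0 goodF (m := [:: k1]) [:: [::], b & singles (xyz k1 k2 k3 i j k)] isT.
rewrite /= (Dw_xyz goodF) //= !mul1n !expr0 !mul1r.
rewrite (Fw_swap goodF [::]) /= mul1n sqrrN expr1n mulN1r.
rewrite (Fw_nuniq goodF [:: [::]]) /= ?inE ?eqxx ?orbT //.
rewrite (G_nuniq _ _ _ [:: [::]; b]) /= ?inE ?eqxx // mulr0 !add0r.
have -> : G [:: [::]; b; [:: k1; k3]] i j k.-1 = 0.
  rewrite /Gw /= (Fw_13 [:: [::]; b]) (Fw_even_dup goodF [:: [::]]) //; exact: oppr0.
by rewrite mulr0 addr0.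
Qed.

(** Multiplied by j + 1, both sides equal the value of [b] without empty letter: by letting [k1]
    act, and by trading [b] for [t]. *)
Lemma empty_bc i j k : G [:: [::]; b; c] i j k = - G [:: [::]; t] i.+1 j k.
Proof.
have := D1_empty_b i j.+1 k; have := b_to_full i.+1 j.+1 k => /=.
move=> H1 H2; have: j.+1%:R * (G [:: [::]; b; c] i j k + G [:: [::]; t] i.+1 j k) = 0.
  by rewrite mulrDr; lra.
by move/eqP; rewrite mulf_eq0 pnatr_eq0 /= addr_eq0 => /eqP.
Qed.

End Relations.

Section Top.
Variables k1 k2 k3 : 'I_3.
Hypothesis uniqk : uniq [:: k1; k2; k3].
Local Notation G := (Gw F k1 k2 k3).
Local Notation a := [:: k2; k3].
Local Notation b := [:: k3; k1].
Local Notation c := [:: k1; k2].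
Local Notation t := [:: k1; k2; k3].

Lemma empty_ca i j k : G [:: [::]; c; a] i j k = - G [:: [::]; t] i j.+1 k.
Proof.
have := empty_bc (uniqk_rot uniqk) j k i.
by rewrite !(Gw_rot k1 k2 k3) => ->; rewrite /Gw (Fw_t1 k1 k2 k3 [:: [::]]).
Qed.

Lemma empty_ab i j k : G [:: [::]; a; b] i j k = - G [:: [::]; t] i j k.+1.
Proof.
have := empty_bc (uniqk_rot (uniqk_rot uniqk)) k i j.
by rewrite -!(Gw_rot k3 k1 k2) => ->; rewrite /Gw (Fw_t2 k1 k2 k3 [:: [::]]).
Qed.

(** Every term of [D1_empty_a] is a multiple of this value. The coefficients i + 1, 1, j and k have
    the same sign and add up to the length of the list. *)
Lemma empty_full i j k : G [:: [::]; t] i j k = 0.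
Proof.
have H1 := D1_empty_a uniqk i j k.
have H2 : G [:: a] i.+1 j k = - (i.+1%:R * G [:: [::]; t] i j k).
  by have := a_to_full uniqk i.+1 j k => /=; lra.
have H3 : j%:R * G [:: [::]; a; c] i j.-1 k = j%:R * G [:: [::]; t] i j k.
  case: j {H1 H2} => [|j]; first by rewrite !mul0r.
  rewrite /Gw (Fw_swap goodF [:: [::]]) /=.
  have := empty_ca i j k; rewrite /Gw /= => ->.
  by rewrite -signr_odd /= expr0 mulN1r opprK.
have H4 : k%:R * G [:: [::]; a; b] i j k.-1 = - (k%:R * G [:: [::]; t] i j k).
  case: k {H1 H2 H3} => [|k]; first by rewrite !mul0r oppr0.
  by rewrite empty_ab /= mulrN.
have : (i.+1 + 1 + j + k)%:R * G [:: [::]; t] i j k = 0.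
  by move: H1; rewrite H2 H3 H4 !natrD !mulrDl mul1r; lra.
by move/eqP; rewrite mulf_eq0 pnatr_eq0 addn1 !addSn /= => /eqP.
Qed.

Lemma two_no_empty i j k : G [:: a; b] i j k = 0.
Proof.
have := c_to_full (uniqk_rot uniqk) j k i (E := [:: b]) isT.
rewrite !(Gw_rot k1 k2 k3).
suff -> : Gw F k1 k2 k3 [:: [::]; b; [:: k2; k3; k1]] i.-1 j k = 0 by rewrite mulr0 addr0.
rewrite /Gw (Fw_t1 _ _ _ [:: [::]; b]) -(Fw_t2 _ _ _ [:: [::]; b]).
have := full_empty_c (uniqk_rot (uniqk_rot uniqk)) k i.-1 j (E := [::]) isT.
by rewrite -!(Gw_rot k3 k1 k2).
Qed.

(** Replace [c] by the single [k2] and let [k1] act: every term dies except the one that turns a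
    [k2] into [c]. *)
Lemma empty_abc i j k : G [:: [::]; a; b; c] i j k = 0.
Proof.
have := Dw0 goodF (m := [:: k1]) [:: [::], a, b & singles (xyz k1 k2 k3 i j.+1 k)] isT.
rewrite /= (Dw_xyz goodF) //= !mul1n !expr0 !mul1r.
have -> : Fw [:: [:: k1], a, b & singles (xyz k1 k2 k3 i j.+1 k)] = 0.
  apply: (Fw_perm0 goodF _ (two_no_empty i.+1 j.+1 k)).
  exact: (perm_front [:: [:: k1]] [:: a; b]).
have -> : Fw [:: [::], t, b & singles (xyz k1 k2 k3 i j.+1 k)] = 0.
  rewrite -(Fw_t2 _ _ _ [:: [::]]).
  have := full_empty_c (uniqk_rot (uniqk_rot uniqk)) k i j.+1 (E := [::]) isT.
  rewrite -!(Gw_rot k3 k1 k2); apply: (Fw_perm0 goodF).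
  rewrite /= perm_cons; exact: (perm_front [:: _] [:: b]).
rewrite (Fw_nuniq goodF [:: [::]; a]) /= ?inE ?eqxx ?orbT //.
rewrite (G_nuniq _ _ _ [:: [::]; a; b]) /= ?inE ?eqxx //.
have -> : G [:: [::]; a; b; [:: k1; k3]] i j.+1 k.-1 = 0.
  by rewrite /Gw /= (Fw_13 _ _ [:: [::]; a; b]) (Fw_even_dup goodF [:: [::]; a]) // oppr0.
rewrite !mulr0 !add0r addr0.
by move/eqP; rewrite mulf_eq0 pnatr_eq0 /= => /eqP.
Qed.

End Top.

End Vanishing.

(** * The shapes of letter lists on which a good function can be nonzero *)

Section NormalForm.
Variable n : nat.
Local Notation N := n.+1.
Variable F : seq (gen N) -> rat.
Hypothesis goodF : good F.
Notation letter := (seq 'I_3).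
Local Notation Fw := (Fw F).
Local Notation G := (Gw F 0 1 2).

Definition la : letter := [:: 1; 2].
Definition lb : letter := [:: 2; 0].
Definition lc : letter := [:: 0; 1].
Definition lfull : letter := [:: 0; 1; 2].
Definition pairs : seq letter := [:: la; lb; lc].
Definition bigs : seq letter := lfull :: pairs.
Definition canon : seq letter := [:: [::]; [:: 0]; [:: 1]; [:: 2]] ++ bigs.

Lemma uniq012 : uniq [:: 0; 1; 2 : 'I_3]. Proof. by []. Qed.

Lemma pairsP l : l \in pairs -> exists k1 k2 k3 : 'I_3,
  [/\ uniq [:: k1; k2; k3], l = [:: k1; k2] &
      forall P Q, Fw (P ++ [:: k1; k2; k3] :: Q) = Fw (P ++ lfull :: Q)].
Proof.
rewrite !inE => /or3P[] /eqP->.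
- by exists 1, 2, 0; split=> // P Q; rewrite (Fw_t1 goodF).
- by exists 2, 0, 1; split=> // P Q; rewrite (Fw_t2 goodF).
- by exists 0, 1, 2.
Qed.

Lemma count_xyz (k1 k2 k3 k : 'I_3) i j l :
  count_mem k (xyz k1 k2 k3 i j l) = (i * (k1 == k) + (j * (k2 == k) + l * (k3 == k)))%N.
Proof. by rewrite !count_cat !count_nseq /= ![(_ * nat_of_bool _)%N]mulnC. Qed.

Lemma perm_xyz (k1 k2 k3 : 'I_3) X : uniq [:: k1; k2; k3] ->
  perm_eq X (xyz k1 k2 k3 (count_mem k1 X) (count_mem k2 X) (count_mem k3 X)).
Proof.
move=> uk; apply/allP=> k _; apply/eqP; rewrite [RHS]count_xyz.
move: uk; rewrite /= !inE negb_or andbT => /andP[/andP[/negPf n12 /negPf n13] /negPf n23].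
have: k \in [:: k1; k2; k3].
  have [] := @uniq_min_size _ [:: k1; k2; k3] (enum 'I_3).
  - by rewrite /= !inE n12 n13 n23.
  - by move=> ? _; rewrite mem_enum.
  - by rewrite size_enum_ord.
  by move=> _ ->; rewrite mem_enum.
have n21 : (k2 == k1) = false by rewrite eq_sym.
have n31 : (k3 == k1) = false by rewrite eq_sym.
have n32 : (k3 == k2) = false by rewrite eq_sym.
by rewrite !inE => /or3P[] /eqP->;
  rewrite eqxx ?(n12, n13, n23, n21, n31, n32) !muln0 !muln1 ?addn0 ?add0n.
Qed.

Lemma Fw_xyz P X : Fw (P ++ singles X) = G P (count_mem 0 X) (count_mem 1 X) (count_mem 2 X).
Proof. by rewrite /Gw -(Fw_singles goodF (perm_xyz X uniq012)). Qed.

Lemma bigs_size E : all (mem bigs) E -> all (fun l : letter => (1 < size l)%N) E.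
Proof. by apply: sub_all => l; rewrite !inE => /or4P[] /eqP->. Qed.

Lemma pair_full_empty l E X : l \in pairs -> all (mem bigs) E ->
  Fw ([:: [::]; l] ++ E ++ lfull :: singles X) = 0.
Proof.
move=> /pairsP[k1 [k2 [k3 [uk -> eqt]]]] bE.
rewrite catA -eqt -cat_rcons (Fw_singles goodF (perm_xyz X uk)) -cats1.
rewrite -[(_ ++ E) ++ _]catA; apply: (full_empty_c goodF uk); exact: bigs_size.
Qed.

(** With [full_empty_of] this reads [c_to_full] as an equivalence between the vanishing of two
    families. *)
Lemma pair_no_empty_of l E : l \in pairs -> all (mem bigs) E ->
  (forall X, Fw ([::] :: E ++ lfull :: singles X) = 0) ->
  forall X, Fw (l :: E ++ singles X) = 0.
Proof.
move=> /pairsP[k1 [k2 [k3 [uk -> eqt]]]] bE H0 X.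
rewrite -cat_cons (Fw_singles goodF (perm_xyz X uk)).
have := c_to_full goodF uk (count_mem k1 X) (count_mem k2 X) (count_mem k3 X) (bigs_size bE).
rewrite /Gw -[([::] :: E ++ _) ++ _]/([::] :: (E ++ _) ++ _) -catA -cat_cons eqt.
by rewrite [Fw (([::] :: E) ++ _)]H0 mulr0 addr0.
Qed.

Lemma full_empty_of l E : l \in pairs -> all (mem bigs) E ->
  (forall X, Fw (l :: E ++ singles X) = 0) ->
  forall X, Fw ([::] :: E ++ lfull :: singles X) = 0.
Proof.
move=> /pairsP[k1 [k2 [k3 [uk -> eqt]]]] bE H0 X.
rewrite -cat_cons -eqt -cat_rcons (Fw_singles goodF (perm_xyz X uk)) cat_rcons.
have := c_to_full goodF uk (count_mem k1 X) (count_mem k2 X) (count_mem k3 X).+1 (bigs_size bE).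
rewrite /Gw -[([::] :: E ++ _) ++ _]/([::] :: (E ++ _) ++ _) -catA.
rewrite -[(_ :: E) ++ _ in X in X + _]/(_ :: E ++ _) H0 add0r.
by move/eqP; rewrite mulf_eq0 pnatr_eq0 => /eqP.
Qed.

Lemma no_empty_bigs E : all (mem bigs) E -> [::] \notin E.
Proof. by move=> /allP bE; apply/negP => /bE. Qed.

Lemma no_empty_singles X : [::] \notin singles X.
Proof. by elim: X. Qed.

(** With a full letter in [E], [full_no_empty] applies. Otherwise the pair is traded for an empty
    and a full letter, which vanish alone by [empty_full] and beside another pair by
    [pair_full_empty]. *)
Lemma pair_no_empty l E X : l \in pairs -> all (mem bigs) E ->
  Fw (l :: E ++ singles X) = 0.
Proof.
move=> lp bE; have [tE|tE] := boolP (lfull \in E).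
  apply: (Fw_perm0 goodF (L' := lfull :: (l :: rem lfull E) ++ singles X)).
    rewrite -!cat_cons perm_cat2r (perm_trans _ (perm_front [:: l] [:: lfull] _)) //=.
    by rewrite perm_cons perm_to_rem.
  apply: (full_no_empty goodF).
  rewrite mem_cat negb_or no_empty_singles inE negb_or andbT.
  apply/andP; split; first by apply: contraTneq lp => <-.
  by apply: contra (no_empty_bigs bE); apply: mem_rem.
apply: (pair_no_empty_of lp bE) => {}X; case: E bE tE => [|l' E] bE tE.
  by rewrite (Fw_xyz [:: [::]; lfull]) (empty_full goodF).
move: bE tE => /= /andP[bl' bE]; rewrite !inE negb_or => /andP[nl' _].
rewrite [Fw _](@pair_full_empty l' E X) //.
by move: bl'; rewrite !inE eq_sym (negPf nl').
Qed.

Lemma full_empty E X : all (mem bigs) E -> Fw ([::] :: E ++ lfull :: singles X) = 0.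
Proof.
move=> bE; apply: (@full_empty_of la) => // Y; exact: pair_no_empty.
Qed.

Lemma Fw_even_dup_mem (m : letter) L : ~~ odd (size m) -> (1 < count_mem m L)%N -> Fw L = 0.
Proof.
move=> ev cm; have mL : m \in L by rewrite -has_pred1 has_count; lia.
have eqL := perm_to_rem mL.
have mL' : m \in rem m L.
  rewrite -has_pred1 has_count; move/seq.permP/(_ (pred1 m)): (eqL) => /=.
  by rewrite eqxx => E; move: cm; rewrite E add1n ltnS.
apply: (Fw_perm0 goodF eqL); apply: (Fw_perm0 goodF (L' := [:: m, m & rem m (rem m L)])).
  by rewrite perm_cons perm_to_rem.
exact: (Fw_even_dup goodF [::]).
Qed.

(** Two empty letters give 0. With one, there is no full letter, the pairs are distinct, and two or
    three of them give 0. With none, any big letter gives 0. *)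
Lemma Fw_form z E X : all (mem bigs) E ->
  Fw (nseq z [::] ++ E ++ singles X) <> 0 ->
  [\/ z = 1%N /\ E = [::], z = 0%N /\ E = [::] |
      z = 1%N /\ exists2 l, l \in pairs & E = [:: l]].
Proof.
case: z => [|[|z]] bE /=; last first.
  by case; exact: (Fw_even_dup goodF [::]).
- move=> Fn0; have [tE|tE] := boolP (lfull \in E).
    case: Fn0; apply: (Fw_perm0 goodF (L' := [::] :: rem lfull E ++ lfull :: singles X)).
      rewrite perm_cons -cat_rcons perm_cat2r -cats1 perm_sym perm_catC perm_sym.
      exact: perm_to_rem.
    apply: full_empty; apply/allP=> l /mem_rem; exact: (allP bE).
  have pE : all (mem pairs) E.
    apply/allP=> l lE; have := allP bE _ lE; rewrite !inE.
    by case: eqP => // el; rewrite -el lE in tE.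
  have [uE|nuE] := boolP (uniq E); last first.
    case: Fn0; have [l [lE cl]] : exists l, l \in E /\ (1 < count_mem l E)%N.
      elim: E nuE {bE tE pE} => [|l E IH] //=; rewrite negb_and negbK.
      case/orP=> [lE|/IH[l' [l'E cl']]].
        exists l; rewrite mem_head eqxx add1n ltnS; split=> //.
        by rewrite -has_count has_pred1.
      by exists l'; rewrite inE l'E orbT; split=> //; rewrite (leq_trans cl') ?leq_addl.
    apply: (Fw_even_dup_mem (m := l)).
      by have := allP pE _ lE; rewrite !inE => /or3P[] /eqP->.
    by rewrite /= count_cat (leq_trans cl) // addnCA leq_addr.
  have eqE : perm_eq E (filter (mem E) pairs).
    apply: uniq_perm => //; first exact: filter_uniq.
    move=> l; rewrite mem_filter /= andb_idr //.
    by move=> /(allP pE).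
  have perm0 E' : perm_eq E E' -> Fw ([::] :: E' ++ singles X) = 0 -> False.
    move=> eq' F0; apply: Fn0; apply: (Fw_perm0 goodF _ F0).
    by rewrite perm_cons perm_cat2r.
  have sz1 : (size E = 0 \/ size E = 1 -> [\/ 1 = 1 /\ E = [::], 1 = 0 /\ E = [::] |
      1 = 1 /\ exists2 l, l \in pairs & E = [:: l]])%N.
    case: E pE {bE tE uE eqE perm0 Fn0} => [|l [|l' E]] pE; first by constructor 1.
      2: by case.
    by constructor 3; split=> //; exists l => //; case/andP: pE.
  move: eqE => /=.
  (* Of the eight subsets of [pairs], those with at most one element are the allowed shapes; the
     other four vanish. *)
  case: (la \in E); case: (lb \in E); case: (lc \in E) => eqE;
    try (by apply: sz1; rewrite (perm_size eqE) /=; auto);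
    case: (perm0 _ eqE).
  + exact: etrans (Fw_xyz [:: [::]; la; lb; lc] X) (empty_abc goodF uniq012 _ _ _).
  + rewrite (Fw_xyz [:: [::]; la; lb] X) (empty_ab goodF uniq012) (empty_full goodF uniq012).
    by rewrite oppr0.
  + apply: (Fw_perm0 goodF (L' := [:: [::]; lc; la] ++ singles X)).
      rewrite perm_cons; exact: (perm_front [:: la] [:: lc]).
    rewrite (Fw_xyz [:: [::]; lc; la] X) (empty_ca goodF uniq012) (empty_full goodF uniq012).
    by rewrite oppr0.
  + rewrite (Fw_xyz [:: [::]; lb; lc] X) (empty_bc goodF uniq012) (empty_full goodF uniq012).
    by rewrite oppr0.
case: E bE => [|l E] bE Fn0; first by constructor 2.
case: Fn0; move: bE => /= /andP[bl bE].
have [->|nl] := eqVneq l lfull.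
  apply: (full_no_empty goodF).
  by rewrite mem_cat negb_or no_empty_singles no_empty_bigs.
apply: pair_no_empty => //; by move: bl; rewrite !inE (negPf nl).
Qed.

End NormalForm.

(** * Reduction of monomials to one value per tridegree *)

Section Contents.
Variable n : nat.
Local Notation N := n.+1.
Notation letter := (seq 'I_3).

(** The pair of kinds 0 and 2 is written [[:: 2; 0]], following the cyclic convention of [la], [lb],
    [lc], under which the relations rotate without extra signs. *)
Definition letter_of (f : pred 'I_3) : letter :=
  if [&& f 0, ~~ f 1 & f 2] then lb else filter f lfull.

Lemma mem_lt (k : 'I_3) : k \in lfull.
Proof. by case: k => [[|[|[|//]]] ?]. Qed.

Lemma mem_letter_of f k : (k \in letter_of f) = f k.
Proof.
rewrite /letter_of; case: ifP => [/and3P[f0 f1 f2]|_]; last first.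
  by rewrite mem_filter mem_lt andbT.
have := mem_lt k; rewrite !inE => /or3P[] /eqP->; rewrite ?f0 ?f2 //=.
by rewrite (negPf f1).
Qed.

Lemma uniq_letter_of f : uniq (letter_of f).
Proof. by rewrite /letter_of; case: ifP => // _; exact: filter_uniq. Qed.

Lemma letter_of_canon f : letter_of f \in canon.
Proof.
by rewrite /letter_of /=; case: (f 0); case: (f 1); case: (f 2).
Qed.

Definition letters_of (S : {set gen N}) : seq letter :=
  [seq letter_of (fun k => (k, inord p : 'I_N) \in S) | p <- iota 0 N].

Lemma word_flatten o L :
  word n o L = flatten [seq site (inord p) (nth [::] L (p - o)) | p <- iota o (size L)].
Proof.
elim: L o => [|l L IH] o //=; rewrite subnn /=; congr (_ ++ _).
rewrite IH; congr flatten; apply/eq_in_map => p; rewrite mem_iota => /andP[lp _].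
by have -> : (p - o = (p - o.+1).+1)%N by lia.
Qed.

Lemma perm_letters (S : {set gen N}) : perm_eq (enum S) (word n 0 (letters_of S)).
Proof.
have -> : word n 0 (letters_of S) =
   [seq (k, i) | i <- enum 'I_N, k <- letter_of (fun k => (k, i) \in S)].
  rewrite word_flatten size_map size_iota -val_enum_ord -map_comp; congr flatten.
  apply: eq_map => i /=; rewrite /site (nth_map 0%N) ?size_iota ?subn0 //.
  by rewrite nth_iota // add0n inord_val.
apply: uniq_perm; first exact: enum_uniq.
  apply: allpairs_uniq_dep => [|i _|]; [exact: enum_uniq|exact: uniq_letter_of|].
  by move=> [i k] [i' k'] _ _ /= [-> ->].
move=> [k i]; rewrite mem_enum; apply/idP/allpairsPdep => [kS|].
  by exists i, k; rewrite mem_enum mem_letter_of.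
by case=> i' [k' [_ Hk [-> ->]]]; rewrite mem_letter_of in Hk.
Qed.

Lemma count_word (k : 'I_3) o L :
  count (fun g : gen N => g.1 == k) (word n o L) = count_mem k (flatten L).
Proof.
elim: L o => [|l L IH] o //=; rewrite !count_cat IH count_map; congr (_ + _)%N.
Qed.

Lemma ndeg_letters k S : ndeg k S = count_mem k (flatten (letters_of S)).
Proof.
rewrite -(count_word k 0) -(seq.permP (perm_letters S)) /ndeg cardE -size_filter.
apply/perm_size/uniq_perm; [exact: enum_uniq|exact/filter_uniq/enum_uniq|].
by move=> g; rewrite mem_filter !mem_enum inE andbC.
Qed.

Lemma canon_form (L : seq letter) : all (mem canon) L ->
  exists z E X, perm_eq L (nseq z [::] ++ E ++ singles X) /\ all (mem bigs) E.
Proof.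
elim: L => [|l L IH]; first by exists 0%N, [::], [::].
move=> /= /andP[lc /IH[z [E [X [eqL bE]]]]].
have [lb|lb] := boolP (l \in bigs).
  exists z, (l :: E), X; rewrite /= lb; split=> //.
  rewrite perm_sym (perm_catCA _ [:: l]) perm_cons perm_sym.
  exact: eqL.
have: l \in [:: [::]; [:: 0]; [:: 1]; [:: 2]].
  by move: lc; rewrite mem_cat (negPf lb) orbF.
rewrite inE => /orP[/eqP->|]; first by exists z.+1, E, X; rewrite /= perm_cons.
move=> ls; have [k ->] : exists k, l = [:: k].
  by move: ls; rewrite !inE => /or3P[] /eqP->; [exists 0|exists 1|exists 2].
exists z, E, (k :: X); split=> //.
rewrite perm_sym catA (perm_catCA _ [:: [:: k]]) perm_cons -catA perm_sym.
exact: eqL.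
Qed.

Variable F : seq (gen N) -> rat.
Hypothesis goodF : good F.
Local Notation Fw := (Fw F).
Local Notation G := (Gw F 0 1 2).

Lemma D1_empty (k1 k2 k3 : 'I_3) i j k : uniq [:: k1; k2; k3] ->
  Gw F k1 k2 k3 [::] i.+1 j k +
  j%:R * Gw F k1 k2 k3 [:: [::]; [:: k1; k2]] i j.-1 k -
  k%:R * Gw F k1 k2 k3 [:: [::]; [:: k3; k1]] i j k.-1 = 0.
Proof.
move=> uk.
have := Dw0 goodF (m := [:: k1]) [:: [::] & singles (xyz k1 k2 k3 i j k)] isT.
rewrite /= (Dw_xyz goodF) //= !mul1n !expr0 !mul1r.
rewrite (G_nuniq goodF _ _ _ [:: [::]]) /= ?inE ?eqxx // mulr0 add0r.
have -> : Gw F k1 k2 k3 [:: [::]; [:: k1; k3]] i j k.-1 =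
          - Gw F k1 k2 k3 [:: [::]; [:: k3; k1]] i j k.-1.
  exact: (Fw_13 goodF _ _ [:: [::]]).
rewrite -[Fw _]/(Gw F k1 k2 k3 [::] i.+1 j k) mulrN; lra.
Qed.

Lemma D1_empty' i j k :
  [/\ G [::] i.+1 j k + j%:R * G [:: [::]; lc] i j.-1 k - k%:R * G [:: [::]; lb] i j k.-1 = 0,
      G [::] i j.+1 k + k%:R * G [:: [::]; la] i j k.-1 - i%:R * G [:: [::]; lc] i.-1 j k = 0 &
      G [::] i j k.+1 + i%:R * G [:: [::]; lb] i.-1 j k - j%:R * G [:: [::]; la] i j.-1 k = 0].
Proof.
split; first exact: D1_empty.
  by have := @D1_empty 1 2 0 j k i isT; rewrite !(Gw_rot goodF 0 1 2).
by have := @D1_empty 2 0 1 k i j isT; rewrite -!(Gw_rot goodF 2 0 1).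
Qed.

(** [D1_empty'] gives the value on singles alone in two ways; their difference relates the pairs.
    Adding the missing term to both sides of the first yields N C = c (A + B + C), with N = i + j +
    k + 2 and c = k. *)
Lemma pair_rel i j k :
  [/\ (i.+1%:R + j.+1%:R) * G [:: [::]; lc] i j k =
        k%:R * (G [:: [::]; la] i.+1 j k.-1 + G [:: [::]; lb] i j.+1 k.-1),
      (j.+1%:R + k.+1%:R) * G [:: [::]; la] i j k =
        i%:R * (G [:: [::]; lb] i.-1 j.+1 k + G [:: [::]; lc] i.-1 j k.+1) &
      (k.+1%:R + i.+1%:R) * G [:: [::]; lb] i j k =
        j%:R * (G [:: [::]; lc] i j.-1 k.+1 + G [:: [::]; la] i.+1 j.-1 k)].
Proof.
split.
- have [H1 _ _] := D1_empty' i j.+1 k; have [_ H2 _] := D1_empty' i.+1 j k.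
  by move: H1 H2 => /=; rewrite mulrDr mulrDl; lra.
- have [_ H1 _] := D1_empty' i j k.+1; have [_ _ H2] := D1_empty' i j.+1 k.
  by move: H1 H2 => /=; rewrite mulrDr mulrDl; lra.
have [_ _ H1] := D1_empty' i.+1 j k; have [H2 _ _] := D1_empty' i j k.+1.
by move: H1 H2 => /=; rewrite mulrDr mulrDl; lra.
Qed.

(** If one of a, b, c is 0, at most one configuration exists and its relation has right side 0.
    Otherwise C = 0 forces A = - B, and then (a + b + c) A = 0. *)
Lemma pairs_vanish a b c :
  ((0 < a)%N -> (0 < b)%N -> (0 < c)%N -> G [:: [::]; lc] a.-1 b.-1 c = 0) ->
  [/\ (0 < a)%N -> (0 < b)%N -> G [:: [::]; lc] a.-1 b.-1 c = 0,
      (0 < b)%N -> (0 < c)%N -> G [:: [::]; la] a b.-1 c.-1 = 0 &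
      (0 < a)%N -> (0 < c)%N -> G [:: [::]; lb] a.-1 b c.-1 = 0].
Proof.
have pos (p q : nat) (x : rat) : (p.+1%:R + q.+1%:R) * x = 0 -> x = 0.
  by rewrite -natrD => /eqP; rewrite mulf_eq0 pnatr_eq0 => /eqP.
move=> piv; case: a b c piv => [|a] [|b] [|c] //= piv; split=> // _ _.
- by have [_ H _] := pair_rel 0 b c; apply: (pos b c); rewrite H mul0r.
- by have [_ _ H] := pair_rel a 0 c; apply: (pos c a); rewrite H mul0r.
- by have [H _ _] := pair_rel a b 0; apply: (pos a b); rewrite H mul0r.
- exact: piv.
all: have C0 := piv isT isT isT.
all: have [H1 _ _] := pair_rel a b c.+1; have [_ H2 _] := pair_rel a.+1 b c;
  have [_ _ H3] := pair_rel a b.+1 c.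
all: move: H1 H2 H3; rewrite /= C0 mulr0 => H1 H2 H3.
all: have AB : G [:: [::]; la] a.+1 b c + G [:: [::]; lb] a b.+1 c = 0
  by apply/eqP; move/esym/eqP: H1; rewrite mulf_eq0 pnatr_eq0.
- have : (b.+1 + c.+1 + a.+1)%:R * G [:: [::]; la] a.+1 b c = 0.
    have EB : G [:: [::]; lb] a b.+1 c = - G [:: [::]; la] a.+1 b c by lra.
    move: H2; rewrite EB addr0 mulrN => H2.
    by rewrite !natrD 2!mulrDl; lra.
  by move/eqP; rewrite mulf_eq0 pnatr_eq0 => /eqP.
have : (c.+1 + a.+1 + b.+1)%:R * G [:: [::]; lb] a b.+1 c = 0.
  have EA : G [:: [::]; la] a.+1 b c = - G [:: [::]; lb] a b.+1 c by lra.
  move: H3; rewrite EA add0r mulrN => H3.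
  by rewrite !natrD 2!mulrDl; lra.
by move/eqP; rewrite mulf_eq0 pnatr_eq0 => /eqP.
Qed.

Lemma count_singles (k : 'I_3) X : count_mem k (flatten (singles X)) = count_mem k X.
Proof. by elim: X => //= k' X ->; rewrite ?addn0. Qed.

Lemma size_kinds (X : seq 'I_3) :
  size X = (count_mem 0%R X + count_mem 1%R X + count_mem 2%R X)%N.
Proof.
by rewrite {1}(perm_size (perm_xyz X uniq012)) !size_cat !size_nseq addnA.
Qed.

(* In each tridegree a good function is determined by one value. *)
Lemma good_vanish a b c (S : {set gen N}) : trideg a b c S ->
  ((a + b + c)%N = n -> G [:: [::]] a b c = 0) ->
  ((a + b + c)%N = N -> (0 < a)%N -> (0 < b)%N -> (0 < c)%N ->
     G [:: [::]; lc] a.-1 b.-1 c = 0) ->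
  F (enum S) = 0.
Proof.
move=> /and3P[/eqP Ha /eqP Hb /eqP Hc] piv1 piv2.
have altF : alternating (F : seq (gen N) -> rat^o) by case: goodF.
apply: (alt_perm0 altF (perm_letters S)).
have szL : size (letters_of S) = N by rewrite size_map size_iota.
suff: Fw (letters_of S) = 0 by rewrite FwE.
have [|z [E [X [eqL bE]]]] := @canon_form (letters_of S).
  by apply/allP=> _ /mapP[p _ ->]; exact: letter_of_canon.
have cnt (k : 'I_3) : ndeg k S = (count_mem k (flatten E) + count_mem k X)%N.
  rewrite ndeg_letters (seq.permP (perm_flatten eqL)) !flatten_cat !count_cat count_singles.
  by have -> : flatten (nseq z [::]) = [::] :> seq 'I_3 by elim: (z).
apply: (Fw_perm0 goodF eqL); apply/eqP/negPn/negP => /eqP Fn0.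
have szX : (z + (size E + size X) = N)%N.
  by rewrite -szL (perm_size eqL) !size_cat size_nseq size_map.
rewrite size_kinds in szX.
have [] := Fw_form goodF bE Fn0.
- move=> [ez eE]; case: Fn0.
  have cnt' (k : 'I_3) : count_mem k X = ndeg k S by rewrite cnt eE.
  move: szX; rewrite ez eE (Fw_xyz goodF [:: [::]]) !cnt' Ha Hb Hc.
  by rewrite add0n add1n => -[/piv1].
- move=> [ez eE]; case: Fn0.
  have cnt' (k : 'I_3) : count_mem k X = ndeg k S by rewrite cnt eE.
  move: szX; rewrite ez eE !cnt' Ha Hb Hc !add0n => szX.
  have [Hlc Hla Hlb] := pairs_vanish (piv2 szX).
  rewrite (Fw_xyz goodF [::]) !cnt' Ha Hb Hc.
  (* The exponents add up to N > 0, so some variable occurs; its relation in [D1_empty'] expresses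
     the value through vanishing pair values. *)
  case: a {Ha piv1 piv2} szX Hlc Hla Hlb => [|a] szX Hlc Hla Hlb; last first.
    have [H _ _] := D1_empty' a b c; move: H Hlc Hlb.
    case: b {Hb szX Hla} => [|b]; case: c {Hc} => [|c] /= H Hlc Hlb;
      rewrite ?mul0r ?Hlc ?Hlb // in H; rewrite ?mulr0 in H; lra.
  case: b {Hb} szX Hlc Hla Hlb => [|b] szX Hlc Hla Hlb; last first.
    have [_ H _] := D1_empty' 0 b c; move: H Hla.
    case: c {Hc szX Hlc Hlb} => [|c] /= H Hla;
      rewrite ?mul0r ?Hla // in H; rewrite ?mulr0 in H; lra.
  case: c {Hc} szX Hlc Hla Hlb => [//|c] szX Hlc Hla Hlb.
  by have [_ _ H] := D1_empty' 0 0 c; rewrite /= !mul0r in H; lra.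
case=> ez [l lp eE]; case: Fn0; move: cnt szX; rewrite ez eE /= cats0 => cnt szX.
rewrite (Fw_xyz goodF [:: [::]; l]).
move: (cnt 0) (cnt 1) (cnt 2); rewrite Ha Hb Hc => Ea Eb Ec.
have szN : (a + b + c)%N = N.
  move: (count_mem 0 X) (count_mem 1 X) (count_mem 2 X) lp szX Ea Eb Ec => x y u.
  by rewrite !inE => /or3P[] /eqP-> /=; lia.
have [Hlc Hla Hlb] := pairs_vanish (piv2 szN).
by move: lp Ea Eb Ec; rewrite !inE => /or3P[] /eqP-> /= Ea Eb Ec;
  [move: Hla|move: Hlb|move: Hlc]; rewrite Ea Eb Ec; apply.
Qed.

End Contents.

(** * Functionals vanishing on the ideal *)

Section IdealVanishing.
Variable n : nat.
Local Notation N := n.+1.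
Local Notation A := (extA N).
Implicit Types (w u v : seq (gen N)) (f : A).

Lemma liftF_act (H : seq (gen N) -> rat^o) s f : alternating H ->
  liftF H (actA s f) = liftF (fun u => H (map (act_gen s) u)) f.
Proof.
move=> altH; rewrite {1}(gprod_decomp f) !linear_sum; apply: eq_bigr => S _.
by rewrite !linearZ /= actA_gprod liftF_gprod.
Qed.

Variables (F : seq (gen N) -> rat) (d : nat).
Hypothesis altF : alternating (F : seq (gen N) -> rat^o).
Hypothesis actF : forall (s : 'S_N) w, F (map (act_gen s) w) = (-1) ^+ s * F w.
Hypothesis sumF : forall k w, \sum_i F ((k, i) :: w) = 0.
Hypothesis degF : forall w, size w != d -> F w = 0.
Hypothesis led : (d <= N)%N.

(** Two sites do not occur in [w]; their transposition fixes [w] and [f] but reverses the sign of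
    [F]. *)
Lemma liftF_inv0_short w f : inv0 f -> (size w < n)%N ->
  liftF (fun u => (F (u ++ w) : rat^o)) f = 0.
Proof.
move=> [inv_f _] sw.
have /card_gt1P[i [j [iw jw nij]]] : (1 < #|[predC (map snd w)]|)%N.
  have e : (#|map snd w| + #|[predC (map snd w)]| = N)%N by rewrite cardC card_ord.
  have le := card_size (map snd w); rewrite size_map in le.
  by rewrite -(ltn_add2l #|map snd w|) e addn1 ltnS (leq_ltn_trans le).
have altFw : alternating (fun u => (F (u ++ w) : rat^o)) by exact: alternating_suffix.
set x := liftF _ _; suff: x = - x by lra.
rewrite {1}/x -(inv_f (tperm i j)) [liftF _ _]liftF_act // -linearN /=.
rewrite /liftF; apply: eq_bigr => S _; rewrite ffunE scaleNr -scalerN; congr (_ *: _).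
have wE : w = map (act_gen (tperm i j)) w.
  rewrite -[LHS]map_id; apply/eq_in_map => -[k l] lw; rewrite /act_gen /= tpermD //.
    apply: contraNneq iw => ->; apply/mapP; by exists (k, l).
  apply: contraNneq jw => ->; apply/mapP; by exists (k, l).
by rewrite [in LHS]wE -map_cat actF odd_tperm nij expr1 mulN1r.
Qed.

Lemma sum_perm_word w g : \sum_(s : 'S_N) F (act_gen s g :: w) = 0.
Proof.
case: g => k i; pose h (j : 'I_N) := \sum_(s : 'S_N) F ((k, s j) :: w).
have hE j : h j = h i.
  rewrite /h (reindex_inj (mulgI (tperm i j))); apply: eq_bigr => s _.
  by rewrite permM tpermR.
have : \sum_j h j = 0.
  by rewrite exchange_big big1 // => s _; rewrite -[RHS](sumF k w) [RHS](reindex_inj (@perm_inj _ s)).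
rewrite (eq_bigr (fun=> h i)) // sumr_const card_ord -mulr_natl => /eqP.
by rewrite mulf_eq0 pnatr_eq0 => /eqP.
Qed.

(** As d <= N, only the linear part of [f] is seen. Averaged over the group it becomes a combination
    of sums over all sites of one kind of variable, which [sumF] kills. *)
Lemma liftF_inv0_long w f : inv0 f -> (n <= size w)%N ->
  liftF (fun u => (F (u ++ w) : rat^o)) f = 0.
Proof.
move=> [inv_f f0] sw; pose H : seq (gen N) -> rat^o := fun u => F (u ++ w).
change (liftF H f = 0).
have altH : alternating H by exact: alternating_suffix.
have : \sum_(s : 'S_N) liftF H (actA s f) = 0.
  rewrite (eq_bigr (fun s => \sum_S f S *: H (map (act_gen s) (enum S)))); last first.
    by move=> s _; rewrite liftF_act.
  rewrite exchange_big big1 // => S _; rewrite -scaler_sumr.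
  have [->|nS] := eqVneq S set0; first by rewrite f0 scale0r.
  rewrite [X in _ *: X](_ : _ = 0) ?scaler0 //.
  have: enum S != [::] by rewrite -size_eq0 -cardE cards_eq0.
  case: (enum S) => [//|g [|g' u]] _; first exact: sum_perm_word.
  rewrite big1 // => s _; apply: degF; rewrite gtn_eqF //=.
  rewrite (leq_ltn_trans led) // size_cat !ltnS; exact: leq_trans sw (leq_addl _ _).
rewrite (eq_bigr (fun=> liftF H f)) => [|s _]; last by rewrite [actA s f]inv_f.
rewrite sumr_const -mulr_natl => /eqP; rewrite mulf_eq0 pnatr_eq0.
case/orP=> [/eqP c0|/eqP //]; by have := fintype0 (1%g : 'S_N); rewrite c0.
Qed.

Lemma liftF_inv0 w f : inv0 f -> liftF (fun u => (F (u ++ w) : rat^o)) f = 0.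
Proof.
move=> inv_f; case: (leqP n (size w)) => sw; first exact: liftF_inv0_long.
exact: liftF_inv0_short.
Qed.

Lemma liftF_ideal x : in_ideal x -> liftF (F : seq (gen N) -> rat^o) x = 0.
Proof.
pose FF : seq (gen N) -> rat^o := F; rewrite -/FF.
move=> /in_idealE[l [Hl ->]]; rewrite linear_sum big_seq big1 // => -[[y f] z] /Hl /= inv_f.
rewrite (gprod_decomp y) !mulA_suml linear_sum big1 //= => S _.
rewrite !mulAZl linearZ /= (gprod_decomp z) (linear_sum (mulA _)) (linear_sum (liftF FF)).
rewrite big1 ?scaler0 //= => T _.
rewrite !linearZ /=; set u := enum S; set v := enum T.
suff -> : liftF FF (mulA (mulA (gprod u) f) (gprod v)) = 0 by rewrite scaler0.
(* Moving [f] to the front gives one common sign, because only its part of degree d - size (u ++ v)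
   is seen. *)
have E : liftF FF (mulA (mulA (gprod u) f) (gprod v)) =
    (-1) ^+ (size u * (d - size (u ++ v))) *: liftF (fun r => (F (r ++ u ++ v) : rat^o)) f.
  rewrite {1}(gprod_decomp f) linear_sum mulA_suml linear_sum /liftF scaler_sumr.
  apply: eq_bigr => U _ /=; rewrite linearZ /= mulAZl linearZ /= -!gprod_cat.
  rewrite [liftF _ _]liftF_gprod // !scalerA mulrC -!scalerA; congr (_ *: _).
  have [sz|sz] := eqVneq (size (enum U ++ u ++ v)) d.
    have B := alt_block altF [::] u (enum U) v; rewrite /= in B.
    rewrite /FF -catA B; congr ((-1) ^+ (_ * _) *: _).
    by rewrite -sz size_cat addnK.
  rewrite /FF degF ?(degF sz) ?scaler0 //.
  by move: sz; rewrite !size_cat addnCA addnA.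
by rewrite E liftF_inv0 // scaler0.
Qed.

End IdealVanishing.

(** * Determinant functionals in degrees N - 1 and N *)

Section Determinants.
Variable n : nat.
Local Notation N := n.+1.
Implicit Types (w : seq (gen N)) (g : gen N).

Definition g0 : gen N := (0, 0).

(** Permuting the columns fixes the row of ones, so the value is sign-equivariant in the sites; a
    second row of ones makes it 0. *)
Definition det_ones (s : 'I_N -> 'I_N) (p : 'I_N) : rat :=
  \det (\matrix_(r < N, j < N) if r == p then 1 else (s r == j)%:R : rat).

Lemma det_ones_ext s s' p : (forall r, r != p -> s r = s' r) ->
  det_ones s p = det_ones s' p.
Proof.
move=> ss'; congr determinant; apply/matrixP => r j; rewrite !mxE.
by case: eqVneq => // /ss' ->.
Qed.

Lemma det_ones_row (t : 'S_N) s p :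
  det_ones (fun r => s (t r)) p = (-1) ^+ t * det_ones s (t p).
Proof.
rewrite /det_ones -det_perm -det_mulmx -row_permE; congr determinant.
by apply/matrixP => r j; rewrite !mxE (inj_eq perm_inj).
Qed.

Lemma det_ones_act (t : 'S_N) s p :
  det_ones (fun r => t (s r)) p = (-1) ^+ t * det_ones s p.
Proof.
rewrite mulrC /det_ones -det_perm -det_mulmx -[t in perm_mx t]invgK -col_permE.
congr determinant; apply/matrixP => r j; rewrite !mxE.
by rewrite (can2_eq (permK t) (permKV t)).
Qed.

(** Multilinearity in row [r]: the unit vectors add up to the row of ones. *)
Lemma det_row_sum (A : 'M[rat]_N) (r : 'I_N) :
  \sum_i \det (\matrix_(p, j) if p == r then (i == j)%:R else A p j) =
  \det (\matrix_(p, j) if p == r then 1 else A p j).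
Proof.
pose M (v : 'I_N -> rat) := \matrix_(p, j) if p == r then v j else A p j.
have detM v : \det (M v) = \sum_j v j * cofactor (M (fun=> 0)) r j.
  rewrite (expand_det_row _ r); apply: eq_bigr => j _; rewrite mxE eqxx; congr (_ * (_ * _)).
  congr determinant; apply/matrixP => p q; rewrite !mxE.
  by rewrite eq_sym (negPf (neq_lift _ _)).
rewrite [RHS](detM (fun=> 1)) (eq_bigr _ (fun i _ => detM (fun j => (i == j)%:R))).
rewrite exchange_big; apply: eq_bigr => j _; rewrite -mulr_suml; congr (_ * _).
rewrite (bigD1 j) //= eqxx big1 ?addr0 // => i /negPf -> //.
Qed.

Lemma det_ones_triangular s (p : 'I_N) : p = 0 -> (forall r, r != 0 -> s r = r) ->
  det_ones s p = 1.
Proof.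
move=> -> sE; rewrite /det_ones -det_tr det_trig.
  by apply: big1 => i _; rewrite !mxE; case: eqP => // /eqP /sE ->; rewrite eqxx.
apply/is_trig_mxP => i j lij; rewrite !mxE; case: eqVneq => [j0|/sE ->].
  by move: lij; rewrite j0.
by rewrite -val_eqE /= gtn_eqF.
Qed.

Lemma nth_swap (w1 w2 : seq (gen N)) g h (r : 'I_N) (p := size w1) : (p.+1 < N)%N ->
  nth g0 (w1 ++ [:: g, h & w2]) r =
  nth g0 (w1 ++ [:: h, g & w2]) (tperm (inord p : 'I_N) (inord p.+1) r).
Proof.
move=> lp; have vp : val (inord p : 'I_N) = p by rewrite /= inordK //; lia.
have vp1 : val (inord p.+1 : 'I_N) = p.+1 by rewrite /= inordK.
rewrite !nth_cat -/p; case: tpermP => [->|->|/eqP n1 /eqP n2].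
- by rewrite vp vp1 ltnn subnn ltnNge leqnSn /= subSnn.
- by rewrite vp vp1 ltnn subnn ltnNge leqnSn /= subSnn.
case: ltnP => // lr.
have : (r - p)%N != 0%N.
  by apply: contraNneq n1 => e; apply/eqP/val_inj; rewrite vp -[LHS](subnK lr) e.
have : (r - p)%N != 1%N.
  by apply: contraNneq n2 => e; apply/eqP/val_inj; rewrite vp1 -[LHS](subnK lr) e.
by case: (r - p)%N => [|[|k]].
Qed.

Section Content.
Variables a b c : nat.

Definition content w : bool :=
  [&& count (fun g => g.1 == 0) w == a, count (fun g => g.1 == 1) w == b &
      count (fun g => g.1 == 2) w == c].

Lemma content_perm w w' : perm_eq w w' -> content w = content w'.
Proof. by move=> /seq.permP eqw; rewrite /content !eqw. Qed.

Lemma content_act s w : content (map (act_gen s) w) = content w.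
Proof. by rewrite /content !count_map. Qed.

Lemma content_size w : content w -> size w = (a + b + c)%N.
Proof.
move=> /and3P[/eqP<- /eqP<- /eqP<-]; rewrite -(size_map fst) size_kinds.
by rewrite !count_map.
Qed.

Lemma content_letters (S : {set gen N}) : content (enum S) = trideg a b c S.
Proof.
have cnt k : count (fun g : gen N => g.1 == k) (enum S) = ndeg k S.
  by rewrite ndeg_letters -(count_word n k 0) (seq.permP (perm_letters S)).
by rewrite /content !cnt.
Qed.

Definition rowsite w (r : 'I_N) : 'I_N := (nth g0 w r).2.
Definition rowkind w (r : 'I_N) : 'I_3 := (nth g0 w r).1.

Lemma swap_perm w1 g h w2 : perm_eq (w1 ++ [:: g, h & w2]) (w1 ++ [:: h, g & w2]).
Proof. by rewrite perm_cat2l (perm_front [:: g] [:: h]). Qed.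

(** [g0] is a placeholder for row 0, the row of ones; the n variables of the word fill the other
    rows. *)
Definition Flow w : rat :=
  if content w then det_ones (rowsite (g0 :: w)) 0 else 0.

Section Low.
Hypothesis deg_n : (a + b + c)%N = n.

Lemma Flow_alt : alternating (Flow : seq (gen N) -> rat^o).
Proof.
move=> w1 g h w2; rewrite /Flow -(content_perm (swap_perm w1 g h w2)).
case: ifP => [/content_size sz|_]; last by rewrite oppr0.
rewrite deg_n size_cat /= in sz.
have lp : ((size (g0 :: w1)).+1 < N)%N by rewrite /=; lia.
pose t := tperm (inord (size (g0 :: w1)) : 'I_N) (inord (size (g0 :: w1)).+1).
rewrite (_ : det_ones _ _ = det_ones (fun r => rowsite (g0 :: w1 ++ [:: h, g & w2]) (t r)) 0).
  rewrite det_ones_row odd_tperm.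
  have -> : inord (size (g0 :: w1)) != inord (size (g0 :: w1)).+1 :> 'I_N.
    by apply/eqP => /(congr1 val); rewrite /= !inordK; lia.
  rewrite tpermD ?expr1 ?mulN1r //; apply/eqP => /(congr1 val); rewrite /= inordK; lia.
by apply: det_ones_ext => r _; congr snd; exact: (@nth_swap (g0 :: w1) w2 g h r lp).
Qed.

Lemma Flow_act (s : 'S_N) w : Flow (map (act_gen s) w) = (-1) ^+ s * Flow w.
Proof.
rewrite /Flow content_act; case: ifP => [/content_size sz|_]; last by rewrite mulr0.
rewrite -det_ones_act; apply: det_ones_ext => r nr.
have [r' er] : exists r' : nat, val r = r'.+1.
  by case: r nr => [[|r'] lr] // _; exists r'.
rewrite /rowsite er /= (nth_map g0) //.
by rewrite sz deg_n -ltnS -er ltn_ord.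
Qed.

Lemma Flow_sum k w : \sum_i Flow ((k, i) :: w) = 0.
Proof.
have [ct|nct] := boolP (content ((k, 0) :: w)); last first.
  by rewrite big1 // => i _; rewrite /Flow ifN.
rewrite (eq_bigr (fun i => det_ones (rowsite (g0 :: (k, i) :: w)) 0)); last first.
  by move=> i _; rewrite /Flow ifT.
have := content_size ct; rewrite deg_n /= => sz; have l1 : (1 < N)%N by rewrite -sz.
pose r1 : 'I_N := inord 1; have v1 : val r1 = 1%N by rewrite /= inordK.
pose B := \matrix_(p < N, j < N) if p == 0 then 1 else (rowsite (g0 :: g0 :: w) p == j)%:R : rat.
rewrite (eq_bigr (fun i => \det (\matrix_(p, j) if p == r1 then (i == j)%:R else B p j))).
  rewrite det_row_sum.
  apply: (@determinant_alternate _ _ _ 0 r1) => [|j].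
    by apply/eqP => /(congr1 val); rewrite v1.
  by rewrite !mxE !eqxx; case: ifP.
move=> i _; congr determinant; apply/matrixP => p j; rewrite !mxE.
have [->|np] := eqVneq p 0.
  by rewrite ifF //; apply/eqP => /(congr1 val); rewrite v1.
have [->|n1] := eqVneq p r1; first by rewrite /rowsite v1.
rewrite /rowsite; move: np n1.
case: p => [[|[|p]] lp] //= _ /eqP[]; by apply: val_inj; rewrite v1.
Qed.

Lemma Flow_deg w : size w != (a + b + c)%N -> Flow w = 0.
Proof. by rewrite /Flow; case: ifP => // /content_size ->; rewrite eqxx. Qed.

Lemma nth_word_singles o X r : (r < size X)%N ->
  nth g0 (word n o (singles X)) r = (nth 0 X r, inord (o + r)).
Proof.
elim: X o r => [|k X IH] o [|r] //= lr; first by rewrite addn0.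
by rewrite IH // addSnnS.
Qed.

Lemma Flow_pivot : Gw Flow 0 1 2 [:: [::]] a b c = 1.
Proof.
rewrite /Gw /Fw /= size_map !size_cat !size_nseq.
rewrite ifT; last by apply/eqP; lia.
rewrite /Flow ifT; last first.
  by rewrite /content !count_word !count_singles !count_xyz !(muln0, muln1, addn0, add0n) !eqxx.
apply: det_ones_triangular => // r nr.
have [r' er] : exists r' : nat, val r = r'.+1.
  by case: r nr => [[|r'] lr] // _; exists r'.
rewrite /rowsite er /= nth_word_singles /=.
  by rewrite add1n -er inord_val.
by rewrite !size_cat !size_nseq addnA deg_n -ltnS -er ltn_ord.
Qed.

End Low.

(** Up to sign, the matrix of the cross product with (a, b, c): antisymmetric, with (a, b, c) in its
    kernel ([eps_content]). *)
Definition eps (k l : 'I_3) : rat :=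
  let f (i j : 'I_3) : rat :=
    if (i == 0) && (j == 1) then c%:R else
    if (i == 1) && (j == 2) then a%:R else
    if (i == 2) && (j == 0) then b%:R else 0 in
  f k l - f l k.

Lemma epsC k l : eps k l = - eps l k.
Proof. by rewrite /eps opprB. Qed.

Lemma eps_diag k : eps k k = 0.
Proof. by rewrite /eps subrr. Qed.

Lemma eps_content k : a%:R * eps k 0 + b%:R * eps k 1 + c%:R * eps k 2 = 0.
Proof.
by have := mem_lt k; rewrite !inE => /or3P[] /eqP->; rewrite /eps /=; ring.
Qed.

(* The weights eps make the sums over a variable cancel: a word of content    *)
(* (a, b, c) has [\sum_q eps k k_q = 0] for every kind k.                     *)
Definition Ftop w : rat :=
  if content w then
    \sum_p \sum_q eps (rowkind w p) (rowkind w q) * (rowsite w p == rowsite w q)%:R *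
      det_ones (rowsite w) p
  else 0.

Section Top.
Hypothesis deg_N : (a + b + c)%N = N.

Lemma Ftop_alt : alternating (Ftop : seq (gen N) -> rat^o).
Proof.
move=> w1 g h w2; rewrite /Ftop -(content_perm (swap_perm w1 g h w2)).
case: ifP => [/content_size sz|_]; last by rewrite oppr0.
rewrite deg_N size_cat /= in sz.
have lp : ((size w1).+1 < N)%N by move: sz; clear; move: (size w1) => p; lia.
pose t := tperm (inord (size w1) : 'I_N) (inord (size w1).+1).
have nE (r : 'I_N) : nth g0 (w1 ++ [:: g, h & w2]) r = nth g0 (w1 ++ [:: h, g & w2]) (t r).
  exact: nth_swap.
set w' := w1 ++ [:: h, g & w2] in nE *.
have oddt : odd_perm t = true.
  rewrite odd_tperm; apply/eqP => /(congr1 val); rewrite /= !inordK //; last exact: ltnW.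
  by move/eqP; rewrite ltn_eqF.
rewrite [X in - X](reindex_inj (@perm_inj _ t)) -sumrN; apply: eq_bigr => p _.
rewrite [X in - X](reindex_inj (@perm_inj _ t)) -sumrN; apply: eq_bigr => q _ /=.
rewrite /rowkind /rowsite !nE -mulrN; congr (_ * _).
rewrite (@det_ones_ext _ (fun r => rowsite w' (t r))).
  by rewrite det_ones_row oddt expr1 mulN1r.
by move=> r _; rewrite nE.
Qed.

Lemma Ftop_act (s : 'S_N) w : Ftop (map (act_gen s) w) = (-1) ^+ s * Ftop w.
Proof.
rewrite /Ftop content_act; case: ifP => [/content_size sz|_]; last by rewrite mulr0.
have nE (r : 'I_N) : nth g0 (map (act_gen s) w) r = act_gen s (nth g0 w r).
  by rewrite (nth_map g0) // sz deg_N.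
rewrite mulr_sumr; apply: eq_bigr => p _; rewrite mulr_sumr; apply: eq_bigr => q _.
rewrite /rowkind /rowsite !nE /= (inj_eq perm_inj) [RHS]mulrCA; congr (_ * _).
by rewrite -det_ones_act; apply: det_ones_ext => r _; rewrite nE.
Qed.

Lemma sum_eps k w : content w -> \sum_q eps k (rowkind w q) = 0.
Proof.
move=> cw; have sz := content_size cw; rewrite deg_N in sz.
have -> : \sum_q eps k (rowkind w q) = \sum_(g <- w) eps k g.1.
  by rewrite (big_nth g0) sz big_mkord.
rewrite -(big_map fst xpredT (eps k)) sum_count (sum_triple uniq012) !count_map.
case/and3P: cw => /eqP ca /eqP cb /eqP cc.
by rewrite -[RHS](eps_content k) -[in RHS]ca -[in RHS]cb -[in RHS]cc.
Qed.

(** Position 0 holds the summed variable. Terms with p = 0 add up to a multiple of the sum of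
    [eps k], which is 0. So do those with q = 0, after exchanging rows 0 and p. For p and q nonzero,
    a second row of ones appears. *)
Lemma Ftop_sum k w : \sum_i Ftop ((k, i) :: w) = 0.
Proof.
have [ct|nct] := boolP (content ((k, 0) :: w)); last first.
  by rewrite big1 // => i _; rewrite /Ftop ifN.
pose W i := (k, i) :: w : seq (gen N); pose ka := rowkind (W 0); pose si := rowsite (W 0).
have kaE i p : rowkind (W i) p = ka p by case: p => [[|p] lp].
have siE i p : p != 0 -> rowsite (W i) p = si p by case: p => [[|p] lp].
have si0 i : rowsite (W i) 0 = i by [].
pose D := det_ones si 0.
have DE i : det_ones (rowsite (W i)) 0 = D by apply: det_ones_ext => r /siE.
have Dp p : p != 0 -> det_ones (rowsite (W (si p))) p = - D.
  move=> np; rewrite -(DE (si p)) (@det_ones_ext _ (fun r => rowsite (W (si p)) (tperm 0 p r))).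
    by rewrite det_ones_row tpermR odd_tperm eq_sym np expr1 mulN1r.
  move=> r nr; case: tpermP => [->|e|//]; last by rewrite e eqxx in nr.
  by rewrite si0 siE.
have D0 p : p != 0 -> \sum_i det_ones (rowsite (W i)) p = 0.
  move=> np.
  pose B := \matrix_(r < N, j < N) if r == p then 1 else (si r == j)%:R : rat.
  rewrite (eq_bigr (fun i => \det (\matrix_(r, j) if r == 0 then (i == j)%:R else B r j))).
    rewrite det_row_sum; apply: (@determinant_alternate _ _ _ 0 p) => [|j]; first by rewrite eq_sym.
    by rewrite !mxE !eqxx (negPf np).
  move=> i _; congr determinant; apply/matrixP => r j; rewrite !mxE.
  have [->|nr] := eqVneq r 0; first by rewrite eq_sym (negPf np).
  by case: eqP => // _; rewrite siE.
rewrite (eq_bigr (fun i => \sum_p \sum_q eps (ka p) (ka q) *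
     (rowsite (W i) p == rowsite (W i) q)%:R * det_ones (rowsite (W i)) p)); last first.
  move=> i _; rewrite /Ftop ifT //; apply: eq_bigr => p _; apply: eq_bigr => q _.
  by rewrite !kaE.
rewrite exchange_big /= (bigD1 0) //=.
have ka0 : ka 0 = k by [].
have sume : \sum_q eps k (ka q) = 0 := sum_eps k ct.
have -> : \sum_i \sum_q eps (ka 0) (ka q) * (rowsite (W i) 0 == rowsite (W i) q)%:R *
    det_ones (rowsite (W i)) 0 = 0.
  transitivity ((\sum_q eps k (ka q)) * D); last by rewrite [X in X * _]sume mul0r.
  rewrite exchange_big /= mulr_suml; apply: eq_bigr => q _.
  rewrite ka0; have [->|nq] := eqVneq q 0.
    by rewrite ka0 eps_diag mul0r big1 // => i _; rewrite !mul0r.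
  rewrite (bigD1 (si q)) //= si0 siE // eqxx DE mulr1 big1 ?addr0 // => i ni.
  by rewrite si0 siE // (negPf ni) mulr0 mul0r.
rewrite add0r (eq_bigr (fun p => D * eps k (ka p))).
  rewrite -mulr_sumr; suff -> : \sum_(p < N | p != 0) eps k (ka p) = 0 by rewrite mulr0.
  by rewrite -[RHS]sume [RHS](bigD1 0) //= ka0 eps_diag add0r.
move=> p np; rewrite exchange_big /= (bigD1 0) //= [X in _ + X]big1 ?addr0.
  rewrite ka0 (bigD1 (si p)) //= si0 siE // eqxx mulr1 Dp // big1 ?addr0.
    by rewrite epsC mulrNN mulrC.
  by move=> i ni; rewrite si0 siE // eq_sym (negPf ni) mulr0 mul0r.
move=> q nq; transitivity (eps (ka p) (ka q) * (si p == si q)%:R *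
    \sum_i det_ones (rowsite (W i)) p); last by rewrite D0 // mulr0.
by rewrite mulr_sumr; apply: eq_bigr => i _; rewrite !siE.
Qed.

Lemma Ftop_deg w : size w != (a + b + c)%N -> Ftop w = 0.
Proof. by rewrite /Ftop; case: ifP => // /content_size ->; rewrite eqxx. Qed.

(** Only positions 0 and 1, the two variables of [lc], share a site; each of the two orders
    contributes c. *)
Lemma Ftop_pivot : (0 < a)%N -> (0 < b)%N ->
  Gw Ftop 0 1 2 [:: [::]; lc] a.-1 b.-1 c = 2 * c%:R.
Proof.
move=> a0 b0; rewrite /Gw /Fw /= size_map !size_cat !size_nseq.
rewrite ifT; last by apply/eqP; lia.
set w := [:: _, _ & _].
have cw : content w.
  rewrite /content /= !count_word !count_singles !count_xyz.
  rewrite !(muln0, muln1, addn0, add0n) /=; apply/and3P; split; apply/eqP; lia.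
have l1 : (1 < N)%N by lia.
pose r1 : 'I_N := inord 1; have v1 : val r1 = 1%N by rewrite /= inordK.
have n10 : r1 != 0 by apply/eqP => /(congr1 val); rewrite v1.
have s0 : rowsite w 0 = r1 by [].
have sE r : r != 0 -> rowsite w r = r.
  case: r => [[|[|r]] lr] // _; apply: val_inj; rewrite /rowsite /=; first by rewrite inordK.
  rewrite nth_word_singles /= ?add2n ?inordK //.
  by rewrite !size_cat !size_nseq; move: lr deg_N a0 b0; clear; lia.
have k0 : rowkind w 0 = 0 by [].
have k1 : rowkind w r1 = 1 by rewrite /rowkind v1.
have D0 : det_ones (rowsite w) 0 = 1 by apply: det_ones_triangular.
have D1 : det_ones (rowsite w) r1 = -1.
  rewrite (@det_ones_ext _ (fun r => rowsite w (tperm 0 r1 r))).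
    by rewrite det_ones_row tpermR odd_tperm eq_sym n10 D0 mulr1.
  move=> r nr; case: tpermP => [->|e|//]; last by rewrite e eqxx in nr.
  by rewrite s0 sE.
rewrite /Ftop cw (bigD1 0) //= [X in _ + X](bigD1 r1) //= addrA [X in _ + X]big1 ?addr0; last first.
  move=> p /andP[np0 np1]; apply: big1 => q _; rewrite sE //.
  have [->|nq0] := eqVneq q 0; first by rewrite s0 (negPf np1) mulr0 mul0r.
  have [->|nq] := eqVneq q p; first by rewrite eps_diag !mul0r.
  by rewrite sE // eq_sym (negPf nq) mulr0 mul0r.
rewrite (bigD1 r1) //= [X in _ + X + _]big1 ?addr0; last first.
  move=> q nq; have [->|nq0] := eqVneq q 0; first by rewrite eps_diag !mul0r.
  by rewrite s0 sE // eq_sym (negPf nq) mulr0 mul0r.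
rewrite (bigD1 0) //= [X in _ + (_ + X)]big1 ?addr0; last first.
  move=> q nq0; have [->|nq] := eqVneq q r1; first by rewrite eps_diag !mul0r.
  by rewrite !sE // eq_sym (negPf nq) mulr0 mul0r.
by rewrite k0 k1 s0 sE // eqxx D0 D1 /eps /=; ring.
Qed.

End Top.
End Content.

End Determinants.

(** * Dimensions and the sign multiplicity *)

Section Dimension.
Variable n : nat.
Local Notation A := (extA n).
Implicit Types (P : A -> Prop) (U : {vspace A}).

(** Classically, adjoin vectors satisfying [P] until none is missing; the codimension bounds the
    number of steps. *)
Lemma vspace_of_Prop P : P 0 -> (forall c x y, P x -> P y -> P (c *: x + y)) ->
  exists U, forall x, x \in U <-> P x.
Proof.
move=> P0 PD.
suff: forall k U, (forall x, x \in U -> P x) -> (\dim (@fullv _ A) - \dim U < k)%N ->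
    exists U', forall x, x \in U' <-> P x.
  by move=> /(_ _ 0%VS); apply => [x|//]; rewrite memv0 => /eqP->.
elim=> [//|k IH] U UP ltk.
have [PU|] := classic (forall x, P x -> x \in U); first by exists U => x; split; auto.
move=> nall; have [x nx] := not_all_ex_not _ _ nall.
have [Px /negP nUx] := imply_to_and _ _ nx.
apply: (IH (U + <[x]>)%VS).
  move=> _ /memv_addP[u uU [_ /vlineP[c ->] ->]].
  by rewrite addrC; apply: PD => //; exact: UP.
have ltU : (\dim U < \dim (U + <[x]>))%N.
  rewrite ltn_neqAle dimvS ?addvSl // andbT; apply: contra nUx => eqd.
  have /eqP -> : U == (U + <[x]>)%VS by rewrite -(geq_leqif (dimv_leqif_eq (addvSl _ _))) (eqP eqd).
  by rewrite memvE addvSr.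
have := dimvS (subvf (U + <[x]>)%VS); lia.
Qed.

Lemma ext_lincombE d (X : 'I_d -> A) (c : 'I_d -> rat) :
  ext_sum [seq ext_scale (c i) (X i) | i : 'I_d] = \sum_i c i *: X i :> A.
Proof.
rewrite [LHS]ext_sumE big_enum; apply: eq_bigr => i _; exact: ext_scaleE.
Qed.

Lemma dimP_vspace P U : (forall x, x \in U <-> P x) -> @dimP n P (\dim U).
Proof.
move=> UP; exists (fun i => (vbasis U)`_i); split; [|split].
- by move=> i; apply/UP/vbasis_mem/mem_nth; rewrite size_tuple.
- move=> c; rewrite ext_lincombE ext_zeroE => c0 i.
  exact: (freeP (basis_free (vbasisP U)) c c0 i).
move=> x /UP xU; exists (fun i => coord (vbasis U) i x).
by rewrite ext_lincombE {1}(coord_vbasis xU).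
Qed.

Lemma ideal_act s (x : A) : in_ideal x -> in_ideal (actA s x).
Proof.
move=> /in_idealE[l [Hl ->]]; apply/in_idealE.
exists [seq (actA s t.1.1, t.1.2, actA s t.2) | t <- l]; split.
  by move=> _ /mapP[t /Hl ? ->].
rewrite linear_sum big_map big_seq [RHS]big_seq; apply: eq_bigr => t /Hl[inv_t _] /=.
by rewrite !actA_mul [actA s t.1.2]inv_t.
Qed.

Lemma signpreE a b c (x : A) : signpre a b c x <->
  in_tri a b c x /\ forall s, in_ideal (actA s x - (-1) ^+ odd_perm s *: x).
Proof.
by split=> -[xt xs]; split=> // s; have := xs s; rewrite ext_scaleE [ext_add _ _]ext_addE scaleNr.
Qed.

Lemma in_triP a b c k (x y : A) :
  in_tri a b c x -> in_tri a b c y -> in_tri a b c (k *: x + y).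
Proof. by move=> xt yt S nS; rewrite !ffunE xt // yt // scaler0 addr0. Qed.

Lemma in_tri0 a b c : @in_tri n a b c (0 : A).
Proof. by move=> S _; rewrite ffunE. Qed.

Lemma idealP k (x y : A) : in_ideal x -> in_ideal y -> in_ideal (k *: x + y).
Proof. by move=> xI yI; apply: idealD => //; exact: ideal_scale. Qed.

Lemma signpreP a b c k (x y : A) :
  signpre a b c x -> signpre a b c y -> signpre a b c (k *: x + y).
Proof.
move=> /signpreE[xt xs] /signpreE[yt ys]; apply/signpreE.
split=> [|s]; first exact: in_triP.
rewrite linearP scalerDr opprD addrACA scalerA mulrC -scalerA -scalerBr.
apply: idealP; [exact: xs|exact: ys].
Qed.

Lemma ideal_tri_signpre a b c (x : A) : ideal_tri a b c x -> signpre a b c x.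
Proof.
move=> [xt xI]; apply/signpreE; split=> // s.
by rewrite addrC -scaleNr; apply: idealP => //; exact: ideal_act.
Qed.

(** The functional is a coordinate of the component complementary to the ideal. *)
Lemma ideal_separate (x : A) : ~ in_ideal x ->
  exists psi : {linear A -> rat^o}, (forall y, in_ideal y -> psi y = 0) /\ psi x <> 0.
Proof.
move=> nI; have [U HU] := vspace_of_Prop (@ideal0 n) idealP.
pose y := x - projv U x.
have [S yS] : exists S, y S != 0.
  apply/existsP; rewrite -negb_forall; apply: contra_notN nI => /forallP y0.
  apply/HU; suff -> : x = projv U x by exact: memv_proj.
  by apply/eqP; rewrite -subr_eq0; apply/eqP/ffunP => S; rewrite [RHS]ffunE; apply/eqP.
pose psi (z : A) : rat^o := (z - projv U z) S.
have psi_lin : linear psi.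
  by move=> k z z'; rewrite /psi linearP !ffunE /= scalerBr opprD addrACA.
pose mx := GRing.isLinear.Build rat A rat^o _ psi psi_lin.
pose Psi : {linear A -> rat^o} := HB.pack psi mx.
exists Psi; split=> [z /HU zU|]; last exact/eqP.
by rewrite /= /psi projv_id // subrr ffunE.
Qed.

End Dimension.

(** * From good functions to sign multiplicities *)

Section SignMultiplicity.
Variable n : nat.
Local Notation N := n.+1.
Local Notation A := (extA N).
Implicit Types (x y : A) (F : seq (gen N) -> rat).

Definition phiF F x : rat^o := liftF (F : seq (gen N) -> rat^o) x.

(** Antisymmetrise a separating functional. Modulo the ideal a permutation acts on [x] by its sign,
    so the value at [x] is N! times the original one. *)
Lemma phiF_good x a b c : signpre a b c x -> ~ in_ideal x ->
  exists F, good F /\ phiF F x <> 0.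
Proof.
move=> /signpreE[_ sx] nI; have [psi [psiI psix]] := ideal_separate nI.
pose phi y : rat^o := \sum_(s : 'S_N) (-1) ^+ s *: psi (actA s y).
have phi_lin : linear phi.
  move=> k y z; rewrite /phi scaler_sumr -big_split; apply: eq_bigr => s _ /=.
  by rewrite (linearP (actA s)) (linearP psi) scalerDr !scalerA [_ * k]mulrC.
pose mx := GRing.isLinear.Build rat A rat^o _ phi phi_lin.
pose Phi : {linear A -> rat^o} := HB.pack phi mx.
have phiN y : phi (- y) = - phi y by exact: (linearN Phi).
exists (fun w => phi (gprod w)); split; [split|].
- by move=> l1 g h l2; rewrite gprod_alt phiN.
- move=> s w; rewrite -actA_gprod /phi mulr_sumr [RHS](reindex_inj (mulgI s)).
  apply: eq_bigr => t _; rewrite actAM odd_permM /= signr_addb mulrA mulrA -expr2.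
  by rewrite sqrr_sign mul1r.
- move=> m w nm; rewrite -(linear_sum Phi) /= (eq_bigr (fun i => mulA (gprod (site i m)) (gprod w))).
    rewrite -mulA_suml -/(psum N m) /phi big1 // => s _.
    have inv_m := psum_inv0 N nm.
    rewrite actA_mul [actA s (psum N m)](proj1 inv_m) psiI ?scaler0 //.
    exact: ideal_inv.
  by move=> i _; rewrite gprod_cat.
have -> : phiF (fun w => phi (gprod w)) x = phi x.
  rewrite -[RHS]/(Phi x) [in RHS](gprod_decomp x) linear_sum; apply: eq_bigr => S _.
  by rewrite linearZ.
have -> : phi x = #|{perm 'I_N}|%:R * psi x.
  rewrite /phi (eq_bigr (fun=> psi x)) ?sumr_const ?mulr_natl // => s _.
  have := psiI _ (sx s); rewrite linearB linearZ => /eqP; rewrite subr_eq0 => /eqP ->.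
  by rewrite scalerA -expr2 sqrr_sign scale1r.
move/eqP; rewrite mulf_eq0 pnatr_eq0 => /orP[/eqP c0|/eqP //].
by have := fintype0 (1%g : 'S_N); rewrite c0.
Qed.

Lemma good_of_ideal F : alternating (F : seq (gen N) -> rat^o) ->
  (forall (s : 'S_N) w, F (map (act_gen s) w) = (-1) ^+ s * F w) ->
  (forall x, in_ideal x -> phiF F x = 0) -> good F.
Proof.
move=> altF actF FI; split=> // m w nm.
have := FI _ (ideal_inv (gprod w) (psum_inv0 N nm)).
rewrite /psum mulA_suml /phiF linear_sum => E; rewrite -[RHS]E; apply: eq_bigr => i _.
by rewrite -gprod_cat /= liftF_gprod.
Qed.

Lemma good_lin F F' k : good F -> good F' -> good (fun w => F w - k * F' w).
Proof.
move=> [altF actF sF] [altF' actF' sF']; split.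
- move=> l1 g h l2; have := altF l1 g h l2; have := altF' l1 g h l2 => -> ->.
  by rewrite mulrN opprB opprK addrC.
- by move=> s w; rewrite actF actF' mulrBr [in RHS]mulrCA.
by move=> m w nm; rewrite sumrB -mulr_sumr sF // sF' // mulr0 subr0.
Qed.

Lemma in_tri_gprod a b c w : content a b c w -> in_tri a b c (gprod w : A).
Proof.
move=> cw S nS; have [uw|nuw] := boolP (uniq w); last first.
  by rewrite (alt_nuniq (@gprod_alt N)) // ffunE.
have pw : perm_eq w (enum [set g in w]).
  by apply: uniq_perm; rewrite ?enum_uniq // => g; rewrite mem_enum inE.
have [k Hk] := alt_perm pw; rewrite (Hk _ _ (@gprod_alt N)) gprod_enum ffunE emonE.
case: eqP => [eS|_]; last by rewrite scaler0.
by rewrite eS -content_letters -(content_perm _ _ _ pw) cw in nS.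
Qed.

Lemma in_tri_sum a b c (I : finType) (f : I -> A) :
  (forall i, in_tri a b c (f i)) -> in_tri a b c (\sum_i f i).
Proof. by move=> ft S nS; rewrite sum_ffunE big1 // => i _; exact: ft. Qed.

Lemma phiF_tri a b c F x : in_tri a b c x ->
  (forall S, trideg a b c S -> F (enum S) = 0) -> phiF F x = 0.
Proof.
move=> xt F0; apply: big1 => S _; have [/F0 ->|/xt ->] := boolP (trideg a b c S).
  by rewrite scaler0.
by rewrite scale0r.
Qed.

Lemma sign_mult0 a b c :
  (forall F, good F -> forall S, trideg a b c S -> F (enum S) = 0) ->
  sign_mult N a b c 0.
Proof.
move=> F0.
have [U HU] := @vspace_of_Prop N (signpre a b c)
  (ideal_tri_signpre (conj (@in_tri0 N a b c) (@ideal0 N))) (@signpreP N a b c).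
exists (\dim U), (\dim U); rewrite subnn; split; first exact: dimP_vspace.
split=> //; apply: dimP_vspace => x; split=> [/HU sx|/ideal_tri_signpre /HU //].
have [xt _] := sx; split=> //; apply: NNPP => /(phiF_good sx)[F [gF]]; apply.
exact: (phiF_tri xt (F0 F gF)).
Qed.

(** The antisymmetrised monomial of [w0] spans a complement of the ideal part: a sign class with its
    [F0]-component removed is killed by every good function, hence lies in the ideal. *)
Lemma sign_mult1 a b c F0 w0 :
  alternating (F0 : seq (gen N) -> rat^o) ->
  (forall (s : 'S_N) w, F0 (map (act_gen s) w) = (-1) ^+ s * F0 w) ->
  (forall x, in_ideal x -> phiF F0 x = 0) ->
  content a b c w0 -> F0 w0 != 0 ->
  (forall F, good F -> F w0 = 0 -> forall S, trideg a b c S -> F (enum S) = 0) ->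
  sign_mult N a b c 1.
Proof.
move=> alt0 act0 I0 cw0 Fw0 det0; have good0 := good_of_ideal alt0 act0 I0.
have [U HU] := @vspace_of_Prop N (signpre a b c)
  (ideal_tri_signpre (conj (@in_tri0 N a b c) (@ideal0 N))) (@signpreP N a b c).
have [W HW] := @vspace_of_Prop N (ideal_tri a b c) (conj (@in_tri0 N a b c) (@ideal0 N))
  (fun k x y '(conj xt xI) '(conj yt yI) => conj (in_triP k xt yt) (idealP k xI yI)).
pose x0 : A := \sum_(s : 'S_N) (-1) ^+ s *: actA s (gprod w0).
have x0U : x0 \in U.
  apply/HU/signpreE; split=> [|s].
    apply: in_tri_sum => s; rewrite -[_ *: _]addr0.
    apply: in_triP; last exact: in_tri0.
    by rewrite actA_gprod; apply: in_tri_gprod; rewrite content_act.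
  suff -> : actA s x0 = (-1) ^+ s *: x0 by rewrite subrr; exact: ideal0.
  rewrite /x0 linear_sum scaler_sumr [RHS](reindex_inj (mulIg s)); apply: eq_bigr => t _ /=.
  rewrite linearZ /= actAM scalerA odd_permM signr_addb [_ ^+ t * _]mulrC mulrA -expr2.
  by rewrite sqrr_sign mul1r.
have phix0 : phiF F0 x0 != 0.
  have -> : phiF F0 x0 = #|{perm 'I_N}|%:R * F0 w0.
    rewrite /phiF linear_sum (eq_bigr (fun=> F0 w0)) ?sumr_const ?mulr_natl // => s _.
    rewrite linearZ /= actA_gprod liftF_gprod // act0.
    by rewrite /GRing.scale /= mulrA -expr2 sqrr_sign mul1r.
  rewrite mulf_eq0 pnatr_eq0 (negPf Fw0) orbF; apply/eqP => c0.
  by have := fintype0 (1%g : 'S_N); rewrite c0.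
have x0W : x0 \notin W by apply: contra phix0 => /HW[_ /I0 ->].
have UW : U = (W + <[x0]>)%VS.
  apply/vspaceP => x; apply/idP/memv_addP => [xU|[u /HW/ideal_tri_signpre/HU uU [v vx ->]]].
    pose k := phiF F0 x / phiF F0 x0; pose y := x - k *: x0.
    have sy : signpre a b c y.
      by apply/HU; rewrite memvB // memvZ.
    have [yt _] := sy.
    exists y; last by exists (k *: x0); [rewrite memvZ ?memv_line | rewrite subrK].
    apply/HW; split=> //; apply: NNPP => /(phiF_good sy)[F [gF]]; apply.
    (* [l] makes [F - l F0] vanish at [w0], so by [det0] it is 0 on the whole tridegree. *)
    pose l := F w0 / F0 w0.
    have E : phiF (fun w => F w - l * F0 w) y = 0.
      apply: (phiF_tri yt); apply: (det0 _ (good_lin l gF good0)).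
      by rewrite /l divfK // subrr.
    have Ey : phiF F0 y = 0.
      by rewrite /phiF linearB linearZ /= /k /GRing.scale /= divfK // subrr.
    suff <- : phiF (fun w => F w - l * F0 w) y = phiF F y by [].
    rewrite -[RHS]subr0 -(mulr0 l) -[in RHS]Ey /phiF /liftF mulr_sumr -sumrB.
    by apply: eq_bigr => S _; rewrite scalerBr; congr (_ - _); rewrite /GRing.scale /= mulrCA.
  have /vlineP[k ->] := vx; by rewrite memvD // memvZ.
exists (\dim U), (\dim W); split; first exact: dimP_vspace.
split; first exact: dimP_vspace.
have x0n : x0 != 0 by apply: contraNneq x0W => ->; exact: mem0v.
rewrite UW dimv_disjoint_sum ?dim_vline ?x0n ?addKn //.
apply/eqP; rewrite -subv0; apply/subvP => x; rewrite memv_cap memv0 => /andP[xW /vlineP[k xk]].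
have [k0|kn] := eqVneq k 0; first by rewrite xk k0 scale0r.
case/negP: x0W; have -> : x0 = k^-1 *: x by rewrite xk scalerA mulVf // scale1r.
exact: memvZ.
Qed.

Definition mult (a b c : nat) : nat :=
  ((a + b + c == n) || [&& a + b + c == N, 0 < a, 0 < b & 0 < c])%N.

Lemma sign_mult_mult a b c : sign_mult N a b c (mult a b c).
(* The word on which [Flow] or [Ftop] is shown to be nonzero is the very word whose value decides in
   [good_vanish]. *)
Proof.
rewrite /mult; have [e1|ne1] := eqVneq (a + b + c)%N n => /=.
  apply: (@sign_mult1 a b c (Flow a b c) (word n 0 ([:: [::]] ++ singles (xyz 0 1 2 a b c)))).
  - exact: Flow_alt.
  - exact: Flow_act.
  - apply: (@liftF_ideal n _ (a + b + c)).
    + exact: Flow_alt.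
    + exact: Flow_act.
    + exact: Flow_sum.
    + exact: Flow_deg.
    by rewrite e1.
  - by rewrite /content !count_word !count_singles !count_xyz !(muln0, muln1, addn0, add0n) !eqxx.
  - have := Flow_pivot e1; rewrite /Gw /Fw ifT => [->//|].
    by rewrite /= size_map !size_cat !size_nseq addnA e1.
  move=> F gF Fw0 S tS; apply: (good_vanish gF tS) => [_|eN].
    by rewrite /Gw /Fw Fw0; case: ifP.
  by move: eN; rewrite e1 => /eqP; rewrite ltn_eqF.
have [/and4P[/eqP eN a0 b0 c0]|nN] := boolP [&& _, _, _ & _].
  apply: (@sign_mult1 a b c (Ftop a b c) (word n 0 ([:: [::]; lc] ++ singles (xyz 0 1 2 a.-1 b.-1 c)))).
  - exact: Ftop_alt.
  - exact: Ftop_act.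
  - apply: (@liftF_ideal n _ (a + b + c)).
    + exact: Ftop_alt.
    + exact: Ftop_act.
    + exact: Ftop_sum.
    + exact: Ftop_deg.
    by rewrite eN.
  - rewrite /content /= !count_word !count_singles !count_xyz.
    rewrite !(muln0, muln1, addn0, add0n) /=; apply/and3P; split; apply/eqP; lia.
  - have := Ftop_pivot eN a0 b0; rewrite /Gw /Fw ifT => [->|].
      by rewrite mulf_neq0 // pnatr_eq0 -lt0n.
    by rewrite /= size_map !size_cat !size_nseq; apply/eqP; lia.
  move=> F gF Fw0 S tS; apply: (good_vanish gF tS) => [/eqP|_ _ _ _].
    by rewrite (negPf ne1).
  by rewrite /Gw /Fw Fw0; case: ifP.
apply: sign_mult0 => F gF S tS; apply: (good_vanish gF tS) => [/eqP|/eqP e a0 b0 c0].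
  by rewrite (negPf ne1).
by rewrite e a0 b0 c0 in nN.
Qed.

End SignMultiplicity.

(** * Schur polynomials in three variables *)

Section Schur.
Implicit Types (m : 'X_{1..3}) (j : int).

Lemma mcoeff_hcomp k m : (hcomp k)@_m = (mdeg m == k)%:R.
Proof.
rewrite /hcomp raddf_sum /=; have [dm|dm] := eqVneq (mdeg m) k.
  have lm : (mdeg m < k.+1)%N by rewrite dm.
  rewrite (bigD1 (BMultinom lm)) /= ?dm //= mcoeffX eqxx big1 ?addr0 // => m' /andP[_ nm].
  by rewrite mcoeffX; case: eqVneq => // e; case/eqP: nm; apply: val_inj.
rewrite big1 // => m' /eqP dm'; rewrite mcoeffX.
by case: eqVneq => // e; rewrite -e dm' eqxx in dm.
Qed.

Lemma mcoeff_hcompZ j m : (hcompZ j)@_m = ((mdeg m)%:Z == j)%:R.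
Proof. by case: j => k /=; rewrite ?mcoeff0 ?mcoeff_hcomp. Qed.

Lemma mcoeffMXn (p : poly3) m0 m : (p * 'X_[m0])@_m = (m0 <= m)%MM%:R * p@_(m - m0).
Proof.
have [le0|nle] := boolP (m0 <= m)%MM.
  by rewrite -{1}(submK le0) addmC mcoeffMX mul1r.
rewrite mul0r; apply: memN_msupp_eq0; apply: contra nle.
move/msuppM_le/allpairsP => [[m1 m2] /= [_]].
by rewrite msuppX inE => /eqP -> ->; rewrite lem_addl.
Qed.

Lemma mcoeff_hX j m0 m :
  (hcompZ j * 'X_[m0])@_m = ((m0 <= m)%MM && ((mdeg m)%:Z == j + (mdeg m0)%:Z))%:R.
Proof.
rewrite mcoeffMXn mcoeff_hcompZ; have [le0|] := boolP (m0 <= m)%MM; last by rewrite mul0r.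
by rewrite mul1r -{2}(submK le0) mdegD PoszD (inj_eq (addIr _)).
Qed.

Lemma mdeg3 m : mdeg m = (m 0%R + m 1%R + m 2%R)%N.
Proof.
rewrite mdegE !big_ord_recl big_ord0 addn0 addnA.
by congr (m _ + m _ + m _)%N; apply: val_inj.
Qed.

Lemma mnm3P m1 m2 : m1 0 = m2 0 -> m1 1 = m2 1 -> m1 2 = m2 2 -> m1 = m2.
Proof.
move=> e0 e1 e2; apply/mnmP => i.
by have := mem_lt i; rewrite !inE => /or3P[] /eqP->.
Qed.

Lemma lem3 m1 m2 :
  (m1 <= m2)%MM = [&& (m1 0%R <= m2 0%R)%N, (m1 1%R <= m2 1%R)%N & (m1 2%R <= m2 2%R)%N].
Proof.
apply/mnm_lepP/and3P => [le|[le0 le1 le2] i]; first by split.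
by have := mem_lt i; rewrite !inE => /or3P[] /eqP->.
Qed.

Definition e1 : poly3 := 'X_0 + 'X_1 + 'X_2.
Definition e2 : poly3 := 'X_0 * 'X_1 + 'X_0 * 'X_2 + 'X_1 * 'X_2.
Definition e3 : poly3 := 'X_0 * 'X_1 * 'X_2.

(** For a monomial of degree j, the right side is an inclusion-exclusion over the variables dividing
    it; this gives 1 because j >= 1 leaves at least one. *)
Lemma hcompZ_rec j : 1 <= j ->
  hcompZ j = hcompZ (j - 1) * e1 - hcompZ (j - 2) * e2 + hcompZ (j - 3) * e3.
Proof.
move=> j1; apply/mpolyP => m; rewrite /e1 /e2 /e3 -!mpolyXD !mulrDr !(mcoeffD, mcoeffN).
rewrite mcoeff_hcompZ !mcoeff_hX !mdegD !mdeg1 !lem3 !mnmDE !mnm1E /= mdeg3.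
have -> : j - 1 + 1%:Z = j by lia.
have -> : j - 2 + (1 + 1)%N%:Z = j by lia.
have -> : j - 3 + (1 + 1 + 1)%N%:Z = j by lia.
case: eqP => [e|_]; last by rewrite !andbF /=; ring.
rewrite !andbT !(addn0, add0n); move: e; case: (m 0) => [|?]; case: (m 1) => [|?]; case: (m 2) => [|?] e //=.
by move: j1; rewrite -e.
Qed.

Lemma hcompZ0 : hcompZ 0 = 1.
Proof.
by apply/mpolyP => m; rewrite mcoeff_hcompZ mcoeff1 -mdeg_eq0.
Qed.

Lemma hcompZ1 : hcompZ 1 = e1.
Proof. by rewrite hcompZ_rec // hcompZ0; rewrite /= !mul0r subr0 addr0 mul1r. Qed.

Lemma hcompZ2 : hcompZ 2 = e1 * e1 - e2.
Proof.
have e11 : 2 - 1 = 1 :> int by []; have e22 : 2 - 2 = 0 :> int by [].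
by rewrite hcompZ_rec // e11 hcompZ1 e22 hcompZ0 /= mul0r addr0 mul1r.
Qed.

Lemma schur3_row (k : nat) : schur3 [:: k%:Z] = hcomp k.
Proof.
rewrite /schur3 (_ : is_partition _ = true) // det_mx11 mxE -[RHS]/(hcompZ k%:Z); congr hcompZ.
by rewrite /=; lia.
Qed.

Lemma det_mx33 (R : comNzRingType) (g : nat -> nat -> R) :
  \det (\matrix_(i < 3, j < 3) g i j) =
  g 0%N 0%N * (g 1%N 1%N * g 2%N 2%N - g 1%N 2%N * g 2%N 1%N)
  - g 0%N 1%N * (g 1%N 0%N * g 2%N 2%N - g 1%N 2%N * g 2%N 0%N)
  + g 0%N 2%N * (g 1%N 0%N * g 2%N 1%N - g 1%N 1%N * g 2%N 0%N).
Proof.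
rewrite (expand_det_row _ 0) !big_ord_recl big_ord0 /cofactor.
rewrite !(expand_det_row _ (0 : 'I_2)) !big_ord_recl !big_ord0 /cofactor !det_mx11 !mxE /=.
rewrite /bump /=; ring.
Qed.

(** The last two Jacobi-Trudi rows are (1, h_1, h_2) and (0, 1, h_1), so the determinant is h_(k+3)
    - e1 h_(k+2) + e2 h_(k+1), and the recursion applies. *)
Lemma schur3_hook (k : nat) : schur3 [:: k.+1%:Z; 1; 1] = e3 * hcomp k.
Proof.
rewrite /schur3 (_ : is_partition _ = true) //.
pose h (i : nat) := hcompZ (k%:Z + i%:Z).
have h0 : h 0%N = hcomp k by rewrite /h addr0.
have h3 : h 3%N = h 2%N * e1 - h 1%N * e2 + h 0%N * e3.
  rewrite /h hcompZ_rec; last by lia.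
  congr (hcompZ _ * _ - hcompZ _ * _ + hcompZ _ * _); lia.
pose g p q := hcompZ (nth 0 [:: k.+1%:Z; 1; 1] p - p%:Z + q%:Z).
have g00 : g 0%N 0%N = h 1%N by congr hcompZ; rewrite /=; lia.
have g01 : g 0%N 1%N = h 2%N by congr hcompZ; rewrite /=; lia.
have g02 : g 0%N 2%N = h 3%N by congr hcompZ; rewrite /=; lia.
have g10 : g 1%N 0%N = 1 by rewrite -hcompZ0.
have g11 : g 1%N 1%N = e1 by rewrite -hcompZ1.
have g12 : g 1%N 2%N = e1 * e1 - e2 by rewrite -hcompZ2.
have g20 : g 2%N 0%N = 0 by [].
have g21 : g 2%N 1%N = 1 by rewrite -hcompZ0.
have g22 : g 2%N 2%N = e1 by rewrite -hcompZ1.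
rewrite (@det_mx33 _ g) g00 g01 g02 g10 g11 g12 g20 g21 g22 h3 -h0; ring.
Qed.

Definition mnm3 a b c : 'X_{1..3} := (U_(0%R) *+ a + U_(1%R) *+ b + U_(2%R) *+ c)%MM.

Lemma mono3E a b c : mono3 a b c = 'X_[mnm3 a b c].
Proof. by rewrite /mono3 !mpolyXn -!mpolyXD. Qed.

Lemma mnm3E a b c m : (mnm3 a b c == m) = [&& a == m 0, b == m 1 & c == m 2].
Proof.
have [v0 v1 v2] : [/\ mnm3 a b c 0 = a, mnm3 a b c 1 = b & mnm3 a b c 2 = c].
  by split; rewrite !mnmDE !mulmnE !mnm1E /= !(mul0n, mul1n, addn0, add0n).
apply/eqP/and3P => [<-|[/eqP e0 /eqP e1 /eqP e2]]; first by rewrite v0 v1 v2 !eqxx.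
by apply: mnm3P; rewrite ?v0 ?v1 ?v2.
Qed.

Lemma sum_mono3 (K : nat) (f : nat -> nat -> nat -> rat) m :
  (forall a b c, (K <= a)%N || (K <= b)%N || (K <= c)%N -> f a b c = 0) ->
  (\sum_(a < K) \sum_(b < K) \sum_(c < K) f a b c *: mono3 a b c)@_m =
  f (m 0) (m 1) (m 2).
Proof.
move=> f0.
have coef a b c : (f a b c *: mono3 a b c)@_m =
    (a == m 0)%:R * ((b == m 1)%:R * ((c == m 2)%:R * f a b c)).
  rewrite mcoeffZ mono3E mcoeffX mnm3E.
  by case: eqP; case: eqP; case: eqP; rewrite /= ?(mul0r, mulr0, mul1r, mulr1).
have pick (x : nat) (h : nat -> rat) : ((K <= x)%N -> h x = 0) ->
    \sum_(a < K) (a == x :> nat)%:R * h a = h x.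
  move=> hx; have [lx|lx] := ltnP x K.
    rewrite (bigD1 (Ordinal lx)) //= eqxx mul1r big1 ?addr0 // => a na.
    by rewrite -val_eqE /= in na; rewrite (negPf na) mul0r.
  rewrite big1 ?hx // => a _; rewrite ltn_eqF ?mul0r //.
  exact: leq_trans (ltn_ord a) lx.
rewrite raddf_sum /=.
transitivity (\sum_(a < K) (a == m 0 :> nat)%:R * f a (m 1) (m 2)).
  apply: eq_bigr => a _; rewrite raddf_sum /=.
  rewrite -(pick (m 1) (fun b => f a b (m 2))) => [|lb]; last by rewrite f0 // lb orbT.
  rewrite mulr_sumr; apply: eq_bigr => b _; rewrite raddf_sum /=.
  rewrite -(pick (m 2) (f a b)) => [|lc]; last by rewrite f0 // lc orbT.
  by rewrite !mulr_sumr; apply: eq_bigr => c _; rewrite coef.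
by apply: (pick (m 0) (fun a => f a (m 1) (m 2))) => la; rewrite f0 // la.
Qed.

(** The factor [e3] selects the monomials of degree n + 1 with all exponents positive. Every
    exponent is below n + 2, so the summation range loses nothing. *)
Lemma mult_sum n :
  \sum_(a < n.+2) \sum_(b < n.+2) \sum_(c < n.+2) (mult n a b c)%:R *: mono3 a b c =
  hcomp n + e3 * hcompZ (n%:Z - 2).
Proof.
apply/mpolyP => m.
rewrite (@sum_mono3 n.+2 (fun a b c => (mult n a b c)%:R)).
  rewrite mcoeffD mcoeff_hcomp mulrC /e3 -!mpolyXD mcoeff_hX !mdegD !mdeg1 mdeg3.
  rewrite !lem3 !mnmDE !mnm1E /= !(addn0, add0n) -natrD /mult; congr _%:R.
  have -> : ((m 0%R + m 1%R + m 2%R)%N%:Z == n%:Z - 2 + (1 + 1 + 1)%N%:Z) =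
            (m 0%R + m 1%R + m 2%R == n.+1)%N by apply/eqP/eqP; lia.
  case: eqVneq => [->|_] /=; last by rewrite add0n; case: eqP; rewrite /= ?andbF ?andbT.
  by rewrite ltn_eqF //= andbF.
move=> a b c H; rewrite /mult.
suff -> : (((a + b + c == n) || [&& a + b + c == n.+1, 0 < a, 0 < b & 0 < c]) = false)%N by [].
by lia.
Qed.

End Schur.

Lemma schur3_row_pred n : schur3 [:: n.+1%:Z - 1] = hcomp n.
Proof. by rewrite -(schur3_row n); congr (schur3 [:: _]); lia. Qed.

Lemma schur3_hook_pred n :
  schur3 [:: n.+1%:Z - 2; 1; 1] = e3 * hcompZ (n%:Z - 2).
Proof.
(* For n = 0 or 1 the shape is not a partition and the index n - 2 is negative, so both sides are
   0. *)
case: n => [|[|n]].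
- by rewrite -[hcompZ _]/(0 : poly3) mulr0.
- by rewrite -[hcompZ _]/(0 : poly3) mulr0.
have -> : n.+3%:Z - 2 = n.+1%:Z by lia.
have -> : n.+2%:Z - 2 = n%:Z by lia.
exact: schur3_hook.
Qed.

Lemma qbinom2_pred n : qbinom2 n = hcompZ (n%:Z - 2).
Proof.
rewrite /qbinom2; case: ifP => [n2|]; last by case: n => [|[|n]].
have -> : n%:Z - 2 = (n - 2)%N%:Z by lia.
exact: schur3_row.
Qed.

Theorem theorem1p1 (n : nat) (hn : (1 <= n)%N) :
  exists m : nat -> nat -> nat -> nat,
    (forall a b c : nat, sign_mult n a b c (m a b c)) /\
    \sum_(a < n.+1) \sum_(b < n.+1) \sum_(c < n.+1)
        (m a b c)%:R *: mono3 a b c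
      = schur3 [:: n%:Z - 1] + schur3 [:: n%:Z - 2; 1; 1] /\
    schur3 [:: n%:Z - 1] + schur3 [:: n%:Z - 2; 1; 1]
      = qbinom2 n.+1 + mono3 1 1 1 * qbinom2 (n - 1).
Proof.
case: n hn => [//|n] _; exists (mult n).
split; [exact: sign_mult_mult|split].
  by rewrite schur3_row_pred schur3_hook_pred mult_sum.
rewrite schur3_row_pred schur3_hook_pred !qbinom2_pred subSS subn0.
have -> : n.+2%:Z - 2 = n%:Z by lia.
by rewrite /mono3 !expr1.
Qed.
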